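(* Let $R$ be a Noetherian $\mathbb{N}$-graded ring, $N \subseteq M$ finitely generated $\mathbb{Z}$-graded $R$-modules ($N$ a graded submodule of $M$), and $I$ an ideal of $R$ generated by homogeneous elements $y_1,\dots,y_c$ of degrees $d_1,\dots,d_c$, respectively. Then the following hold: (1) Let $\mathfrak{p} \in \mathcal{A}^M_N(I) \smallsetminus \mathrm{Ass}_R(0:_M I)$ and $I \subseteq \mathfrak{p}$. Then $\mathfrak{p} \in \mathcal{B}_N(I)$. Moreover, there exist $a_{\mathfrak{p}} \in \{d_1,\dots,d_c\}$ and $b_{\mathfrak{p}} \in \mathbb{Z}$ such that $$v_{\mathfrak{p}}(M/I^nN) = v_{\mathfrak{p}}(I^{n-1}N/I^nN) = a_{\mathfrak{p}}n + b_{\mathfrak{p}} \quad \text{for all } n \gg 0.$$ (2) Let $\mathfrak{p} \in \mathcal{A}^M_N(I) \cap \mathrm{Ass}_R(0:_M I)$. If $d_i \geq 1$ for $1\leq i\leq c$, then $$v_{\mathfrak{p}}(M/I^nN) = v_{\mathfrak{p}}(M) = v_{\mathfrak{p}}(0:_M I) \quad \text{for all } n \gg 0.$$ (3) Let $(0:_M I) \neq 0$. Then $v(M/I^nN) \leq v(0:_M I)$ for all $n \gg 0$. Furthermore, if $d_i \geq 1$ for $1\leq i\leq c$, and if $\mathcal{A}^M_N(I) \subseteq V(I)$, then $$v(M/I^nN) = v(0:_M I) \quad \text{for all } n \gg 0.$$ (4) Let $(0:_M I) = 0$ and $\emptyset \neq \mathcal{A}^M_N(I) \subseteq V(I)$.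 Then $$v(M/I^nN) = v(I^{n-1}N/I^nN) \quad \text{for all } n \gg 0,$$ which is (for $n\gg 0$) linear in $n$ with leading coefficient in $\{d_1,\dots,d_c\}$.
   Context: Rings are commutative; $\mathbb{N}$ includes $0$. $V(I) := \{\mathfrak{p}\in\mathrm{Spec}(R) : I\subseteq\mathfrak{p}\}$ and $(0:_M I) := \{x\in M : Ix=0\}$. It is known that $\mathrm{Ass}_R(M/I^nN)$ and $\mathrm{Ass}_R(I^{n-1}N/I^nN)$ are independent of $n$ for $n \gg 0$; their stable values are denoted $\mathcal{A}^M_N(I)$ and $\mathcal{B}_N(I)$, respectively. For a finitely generated $\mathbb{Z}$-graded $R$-module $L$ with $n$th graded component $L_n$ and $\mathfrak{p}\in\mathrm{Ass}_R(L)$, the local Vasconcelos invariant of $L$ at $\mathfrak{p}$ is $v_{\mathfrak{p}}(L) := \inf\{n : \mathfrak{p} = (0:_R x) \text{ for some } x \in L_n\}$. The Vasconcelos invariant of $L$ is $v(L) := \inf\{v_{\mathfrak{p}}(L) : \mathfrak{p}\in\mathrm{Ass}_R(L)\}$, with the convention $v(0)=\infty$. *)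

(* Defs.v *)
From HB Require Import structures.
From mathcomp Require Import all_boot all_order all_algebra.
From mathcomp Require Import generic_quotient ring_quotient.
From mathcomp Require Import boolp classical_sets filter constructive_ereal.

Set Implicit Arguments.
Unset Strict Implicit.
Unset Printing Implicit Defensive.

Import Order.TTheory GRing.Theory Num.Theory.
Local Open Scope classical_set_scope.
Local Open Scope ring_scope.
Local Open Scope quotient_scope.

(* Submodules of an R-module V are bundled predicates [submodClosed V]; ideals
   of R are submodules of the regular module R^o. *)

Section Span.
Variables (R : comPzRingType) (V : lmodType R).

Definition lspan (A : set V) : {pred V} := fun x =>
  `[< exists (n : nat) (a : 'I_n -> R) (v : 'I_n -> V),
        (forall i, A (v i)) /\ x = \sum_i a i *: v i >].

Lemma lspan_submod (A : set V) : submod_closed (lspan A).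
Proof.
split; first by apply/asboolP; exists 0, (fun=> 0), (fun=> 0); split=> [[]//|];
  rewrite big_ord0.
move=> b x y /asboolP[n [a [v [Av ->]]]] /asboolP[m [c [w [Aw ->]]]].
apply/asboolP; exists (n + m)%N.
exists (fun i => match split i with inl j => b * a j | inr k => c k end).
exists (fun i => match split i with inl j => v j | inr k => w k end).
split=> [i|]; first by case: (split i).
rewrite big_split_ord scaler_sumr; congr (_ + _); apply: eq_bigr => i _.
  by rewrite -[lshift m i]/(unsplit (inl i)) unsplitK scalerA.
by rewrite -[rshift n i]/(unsplit (inr i)) unsplitK.
Qed.

HB.instance Definition _ (A : set V) :=
  GRing.isSubmodClosed.Build R V (lspan A) (lspan_submod A).

Definition finitely_generated : Prop :=
  exists s : seq V, forall x, x \in lspan [set` s].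

(* the submodule J U of V *)
Definition ideal_mul (J : {pred R}) (U : {pred V}) : {pred V} :=
  lspan [set x | exists a u, [/\ a \in J, u \in U & x = a *: u]].

HB.instance Definition _ (J : {pred R}) (U : {pred V}) :=
  GRing.SubmodClosed.on (ideal_mul J U).

(* (0 :_V J) *)
Definition colon0 (J : {pred R}) : {pred V} := fun x =>
  `[< forall a, a \in J -> a *: x = 0 >].

Lemma colon0_submod (J : {pred R}) : submod_closed (colon0 J).
Proof.
split; first by apply/asboolP => a _; rewrite scaler0.
move=> b x y /asboolP Jx /asboolP Jy; apply/asboolP => a Ja.
by rewrite scalerDr scalerA mulrC -scalerA Jx// Jy// scaler0 addr0.
Qed.

HB.instance Definition _ (J : {pred R}) :=
  GRing.isSubmodClosed.Build R V (colon0 J) (colon0_submod J).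

End Span.

Arguments finitely_generated {R} V.
Arguments colon0 {R} V J.

Section Submodule.
Variables (R : comPzRingType) (V : lmodType R) (U : submodClosed V).

Definition submod := {x : V | x \in U}.

HB.instance Definition _ := SubChoice.on submod.
HB.instance Definition _ := [SubChoice_isSubLmodule of submod by <:].

(* the trace on U of a submodule W of V *)
Definition submod_trace (W : {pred V}) : {pred submod} := fun x => val x \in W.

Lemma submod_trace_submod (W : submodClosed V) :
  submod_closed (submod_trace W).
Proof.
have valW x : (x \in submod_trace W) = (val x \in W) by [].
split=> [|a x y]; rewrite !valW ?raddf0 ?rpred0// linearP => Wx Wy.
by rewrite rpredD// rpredZ.
Qed.

HB.instance Definition _ (W : submodClosed V) :=
  GRing.isSubmodClosed.Build R submod (submod_trace W) (submod_trace_submod W).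

End Submodule.

Arguments submod_trace {R V} U W.

Section QuotientModule.
Variables (R : comPzRingType) (V : lmodType R) (U : submodClosed V).

Lemma submodClosed_zmod : zmod_closed U.
Proof. by split=> [|x y Ux Uy]; rewrite ?rpred0// -scaleN1r rpredD// rpredZ. Qed.

Definition submod_zmod : zmodClosed V :=
  HB.pack (GRing.SubmodClosed.sort U)
    (GRing.isZmodClosed.Build V (GRing.SubmodClosed.sort U) submodClosed_zmod).

Definition quotmod := Quotient.quot submod_zmod.

HB.instance Definition _ := GRing.Zmodule.on quotmod.
HB.instance Definition _ := EqQuotient.on quotmod.

Definition quotmod_pi (x : V) : quotmod := \pi_quotmod x.

Definition quotmod_scale (a : R) (x : quotmod) : quotmod :=
  quotmod_pi (a *: repr x).

Lemma quotmod_eq x y : (quotmod_pi x = quotmod_pi y) <-> (x - y \in U).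
Proof.
rewrite -[_ \in U]/(x - y \in submod_zmod) Quotient.idealrBE.
by split=> [/eqP|/eqP].
Qed.

Lemma quotmod_piZ a x : quotmod_scale a (quotmod_pi x) = quotmod_pi (a *: x).
Proof.
apply/quotmod_eq; rewrite -scalerBr rpredZ//; apply/quotmod_eq.
exact: reprK.
Qed.

Lemma quotmod_piD x y : quotmod_pi (x + y) = quotmod_pi x + quotmod_pi y.
Proof. by rewrite /quotmod_pi !piE. Qed.

Lemma quotmod_piP (x : quotmod) : exists y, x = quotmod_pi y.
Proof. by exists (repr x); rewrite /quotmod_pi reprK. Qed.

Lemma quotmod_scaleA a b x :
  quotmod_scale a (quotmod_scale b x) = quotmod_scale (a * b) x.
Proof. by have [y ->] := quotmod_piP x; rewrite !quotmod_piZ scalerA. Qed.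

Lemma quotmod_scale1 : left_id 1 quotmod_scale.
Proof. by move=> x; have [y ->] := quotmod_piP x; rewrite quotmod_piZ scale1r. Qed.

Lemma quotmod_scaleDr : right_distributive quotmod_scale +%R.
Proof.
move=> a x y; have [x' ->] := quotmod_piP x; have [y' ->] := quotmod_piP y.
by rewrite -quotmod_piD !quotmod_piZ -quotmod_piD scalerDr.
Qed.

Lemma quotmod_scaleDl x : {morph quotmod_scale^~ x : a b / a + b}.
Proof.
move=> a b; have [x' ->] := quotmod_piP x.
by rewrite !quotmod_piZ -quotmod_piD scalerDl.
Qed.

HB.instance Definition _ := GRing.Zmodule_isLmodule.Build R quotmod
  quotmod_scaleA quotmod_scale1 quotmod_scaleDr quotmod_scaleDl.

End QuotientModule.

(* U / W for submodules W of U; in general this is U / (U :&: W) *)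
Definition subquot (R : comPzRingType) (V : lmodType R)
    (U W : submodClosed V) : lmodType R :=
  quotmod (submod_trace U W).

Section Ideals.
Variable R : comPzRingType.

Definition noetherian : Prop :=
  forall J : submodClosed R^o,
    exists s : seq R^o, (J : {pred R^o}) =i lspan [set` s].

Fixpoint ideal_exp (J : {pred R}) (n : nat) : {pred R} :=
  if n is n'.+1 then ideal_mul (V := R^o) J (ideal_exp J n') else predT.

Definition Spec : set (set R) := [set p |
  [/\ p 0, forall a b c, p b -> p c -> p (a * b + c), ~ p 1
    & forall a b, p (a * b) -> p a \/ p b]].

Definition zero_locus (J : {pred R}) : set (set R) :=
  [set p | Spec p /\ forall a, a \in J -> p a].

Definition ann (L : lmodType R) (x : L) : set R := [set a | a *: x = 0].

Definition Ass (L : lmodType R) : set (set R) :=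
  [set p | Spec p /\ exists x : L, p = ann x].

(* The value taken by F n for all n >> 0, when F is eventually constant. *)
Definition stable_value T (F : nat -> set T) : set T :=
  [set t | \forall n \near \oo, F n t].

End Ideals.

Section Grading.

(* V is the internal direct sum of its additive subgroups g j *)
Definition direct_sum (J : eqType) (V : zmodType) (g : J -> set V) : Prop :=
  [/\ forall j, g j 0 /\ (forall x y, g j x -> g j y -> g j (x - y)),
      forall x, exists (s : seq J) (f : J -> V),
        (forall j, g j (f j)) /\ x = \sum_(j <- s) f j
    & forall (s : seq J) (f : J -> V), uniq s -> (forall j, g j (f j)) ->
        \sum_(j <- s) f j = 0 -> {in s, forall j, f j = 0}].

Variable R : comPzRingType.

Definition graded_ring (gR : nat -> set R) : Prop :=
  [/\ direct_sum gR, gR 0 1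
    & forall i j a b, gR i a -> gR j b -> gR (i + j)%N (a * b)].

Definition graded_module (gR : nat -> set R) (L : lmodType R)
    (gL : int -> set L) : Prop :=
  direct_sum gL /\
  forall i j a x, gR i a -> gL j x -> gL (i%:Z + j) (a *: x).

End Grading.

Definition submod_grading (R : comPzRingType) (V : lmodType R)
    (g : int -> set V) (U : submodClosed V) : int -> set (submod U) :=
  fun n => [set x | g n (val x)].

Arguments submod_grading {R V} g U.

Definition quotmod_grading (R : comPzRingType) (V : lmodType R)
    (g : int -> set V) (U : submodClosed V) : int -> set (quotmod U) :=
  fun n => quotmod_pi U @` g n.

Arguments quotmod_grading {R V} g U.

Definition subquot_grading (R : comPzRingType) (V : lmodType R)
    (g : int -> set V) (U W : submodClosed V) : int -> set (subquot U W) :=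
  quotmod_grading (submod_grading g U) (submod_trace U W).

Arguments subquot_grading {R V} g U W.

Section Vasconcelos.
Variables (R : comPzRingType) (L : lmodType R) (gL : int -> set L).

(* Both infima are taken in Z extended by -oo and +oo; the first argument of
   [infimum] is its value on the empty set. *)
Definition v_local (p : set R) : \bar int :=
  infimum +oo%E [set n%:E%E | n in [set n | exists2 x, gL n x & p = ann x]].

Definition v_number : \bar int := infimum +oo%E (v_local @` Ass L).

End Vasconcelos.

Section Powers.
Variables (R : comPzRingType) (M : lmodType R) (gM : int -> set M).
Variables (N : {pred M}) (I : {pred R}).

(* I^n N *)
Definition powN (n : nat) : {pred M} := ideal_mul (ideal_exp I n) N.

HB.instance Definition _ n := GRing.SubmodClosed.on (powN n).

(* M / I^n N *)
Definition MmodIN (n : nat) : lmodType R := quotmod (powN n).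
Definition MmodIN_grading (n : nat) : int -> set (MmodIN n) :=
  quotmod_grading gM (powN n).

(* I^(n-1) N / I^n N, relevant for n >= 1 *)
Definition grIN (n : nat) : lmodType R := subquot (powN n.-1) (powN n).
Definition grIN_grading (n : nat) : int -> set (grIN n) :=
  subquot_grading gM (powN n.-1) (powN n).

Definition stableA : set (set R) := stable_value (fun n => Ass (MmodIN n)).
Definition stableB : set (set R) := stable_value (fun n => Ass (grIN n)).

(* (0 :_M I) *)
Definition colonI : lmodType R := submod (colon0 M I).
Definition colonI_grading : int -> set colonI := submod_grading gM (colon0 M I).

End Powers.

Arguments MmodIN_grading {R M} gM N I n.
Arguments grIN_grading {R M} gM N I n.
Arguments colonI_grading {R M} gM I.

(* Main.v *)
(* Applied to M -> M^c, x |-> (y_i x)_i, the Artin-Rees lemma gives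
   (I^n N :_M I) = I^(n-1) N + (0 :_M I) for n >> 0, and applied to (0 :_M I) it
   shows that this sum is direct.  Hence, for a prime p containing I, the
   homogeneous elements with annihilator p in M / I^n N have the same degrees as
   those in I^(n-1) N / I^n N and in (0 :_M I) together.  A prime not containing I
   is associated to all the M / I^n N or to none of them.

   Fix p and let W_n be the set of x in I^n N with p x in I^(n+1) N, and T_n the
   part of W_n killed modulo I^(n+1) N by some a not in p; the degrees in question
   are those of W_n \ T_n.  By Artin-Rees, W_n = I^(n-k) W_k for n >= k.  As R is
   nonnegatively graded, only the monomials y^a w, for w among finitely many
   homogeneous generators of W_k, matter for the least degree.  The exponents a
   with y^a w not in T form a downward closed subset of N^c, that is, a finite
   union of translated faces b + N^F.  On such a face, the least degree is linear
   with slope min {d_i | i in F}.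

   Noetherianity is used for families (K_n) of submodules of I^n N with
   I K_n <= K_(n+1), to which the proof of Hilbert's basis theorem applies
   directly.  It also gives a filtration showing that only finitely many primes
   are associated to some I^(n-1) N / I^n N. *)

Require Import Defs.
From HB Require Import structures.
From mathcomp Require Import all_boot all_order all_algebra.
From mathcomp Require Import generic_quotient ring_quotient.
From mathcomp Require Import boolp classical_sets filter constructive_ereal.
From mathcomp Require Import zify ring.

Set Implicit Arguments.
Unset Strict Implicit.
Unset Printing Implicit Defensive.

Import Order.TTheory GRing.Theory Num.Theory.
Local Open Scope classical_set_scope.
Local Open Scope ring_scope.

(** * Noetherian induction and the Artin-Rees lemma *)

Section AscendingChains.
Variable T : Type.

(** [T] is just a type, so that the condition covers both submodules and sets of pairs of a degree
    and an element. *)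
Definition acc (D : set (set T)) : Prop :=
  forall W : nat -> set T, (forall m, D (W m)) ->
    (forall m, W m `<=` W m.+1) ->
    exists k, forall m, (k <= m)%N -> W m `<=` W k.

Lemma chain_le (W : nat -> set T) : (forall m, W m `<=` W m.+1) ->
  forall m n, (m <= n)%N -> W m `<=` W n.
Proof.
move=> Wm m n /subnKC <-; elim: (n - m)%N => [|k IHk]; first by rewrite addn0.
by rewrite addnS; apply: subset_trans IHk _.
Qed.

Lemma sub_acc (D D' : set (set T)) : D `<=` D' -> acc D' -> acc D.
Proof. by move=> sDD' accD W DW; apply: accD => m; apply: sDD'. Qed.

(** Otherwise choice builds an endless strictly ascending chain of counterexamples, starting from
    [K0]. *)
Lemma acc_ind (D : set (set T)) (Q : set T -> Prop) : acc D ->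
  (forall K, D K ->
     (forall K', D K' -> K `<=` K' -> ~ K' `<=` K -> Q K') -> Q K) ->
  forall K, D K -> Q K.
Proof.
move=> accD step K0 DK0; apply: contrapT => nQ0.
pose X := {K | D K /\ ~ Q K}.
have next (x : X) : {x' : X | sval x `<=` sval x' /\ ~ sval x' `<=` sval x}.
  case: x => K [DK nQ] /=; apply: cid; apply: contrapT => none; apply: nQ.
  apply: step => // K' DK' KK' nK'K; apply: contrapT => nQ'.
  by apply: none; exists (exist _ K' (conj DK' nQ')).
pose W := fix W n : X :=
  if n is n'.+1 then sval (next (W n')) else exist _ K0 (conj DK0 nQ0).
have [k kP] := accD (sval \o W) (fun m => (svalP (W m)).1)
  (fun m => (svalP (next (W m))).1).
exact: (svalP (next (W k))).2 (kP k.+1 (leqnSn k)).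
Qed.

(** The bound is uniform in [j]. The diagonal becomes constant at some [k0], which settles all
    [j >= k0]; each of the finitely many smaller [j] has its own bound, and [k] is the maximum. *)
Lemma acc_double (D : set (set T)) (A : nat -> nat -> set T) : acc D ->
  (forall m j, D (A m j)) -> (forall m j, A m j `<=` A m.+1 j) ->
  (forall m j, A m j `<=` A m j.+1) ->
  exists k, forall m j, (k <= m)%N -> A m j `<=` A k j.
Proof.
move=> accD DA A1 A2.
have A1' j := chain_le (W := A^~ j) (A1^~ j).
have A2' m := chain_le (A2 m).
have Ale m m' j j' : (m <= m')%N -> (j <= j')%N -> A m j `<=` A m' j'.
  by move=> /A1' mm' /A2' jj'; apply: subset_trans (mm' j) (jj' m').
have [k0 k0P] := accD (fun m => A m m) (fun m => DA m m)
  (fun m => Ale _ _ _ _ (leqnSn m) (leqnSn m)).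
have /choice[kj kjP] := fun j => accD (A^~ j) (DA^~ j) (A1^~ j).
exists (maxn k0 (\max_(j < k0) kj j)) => m j.
rewrite geq_max => /andP[k0m kjm]; case: (ltnP j k0) => [jk0|k0j].
  have kjj : (kj j <= \max_(j < k0) kj j)%N.
    exact: (leq_bigmax_cond (F := fun j : 'I_k0 => kj j) (Ordinal jk0)).
  apply: subset_trans (kjP j m (leq_trans kjj kjm)) _.
  by apply: Ale => //; rewrite leq_max kjj orbT.
apply: subset_trans (Ale _ (maxn m j) _ (maxn m j) _ _) _;
  rewrite ?leq_maxl ?leq_maxr//.
apply: subset_trans (k0P _ _) _; first by rewrite leq_max k0m.
by apply: Ale; rewrite // leq_maxl.
Qed.

Lemma acc_max (D X : set (set T)) : acc D -> X `<=` D -> X !=set0 ->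
  exists2 K, X K & forall K', X K' -> K `<=` K' -> K' `<=` K.
Proof.
move=> accD XD [K0 XK0].
apply: (acc_ind (Q := fun K => X K -> _) accD _ (XD _ XK0) XK0) => K _ IH XK.
apply: contrapT => none; apply: (none); exists K => // K' XK' KK'.
apply: contrapT => K'K; apply: none; exact: IH K' (XD _ XK') KK' K'K XK'.
Qed.

End AscendingChains.

Section Submodules.
Variables (R : comPzRingType) (M : lmodType R).
Implicit Types (K U : set M) (x : M).

Definition subm K : Prop := K 0 /\ forall a x y, K x -> K y -> K (a *: x + y).

Lemma subm0 K : subm K -> K 0. Proof. by case. Qed.

Lemma submZ K a x : subm K -> K x -> K (a *: x).
Proof. by case=> K0 KP Kx; rewrite -[_ *: _]addr0; apply: KP. Qed.

Lemma submD K x y : subm K -> K x -> K y -> K (x + y).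
Proof. by case=> K0 KP Kx; rewrite -[x]scale1r; apply: KP. Qed.

Lemma submB K x y : subm K -> K x -> K y -> K (x - y).
Proof. by move=> sK Kx Ky; rewrite -scaleN1r addrC; apply: sK.2. Qed.

Lemma subm_sum K (J : eqType) (s : seq J) (f : J -> M) : subm K ->
  {in s, forall i, K (f i)} -> K (\sum_(i <- s) f i).
Proof.
move=> sK Kf; rewrite big_seq; elim/big_ind: _ => //; first exact: subm0.
by move=> *; apply: submD.
Qed.

Lemma submI K U : subm K -> subm U -> subm (K `&` U).
Proof.
move=> [K0 KP] [U0 UP]; split=> // a x y [? ?] [? ?]; split;
  [exact: KP|exact: UP].
Qed.

Lemma subm_chain (W : nat -> set M) : (forall m, subm (W m)) ->
  (forall m, W m `<=` W m.+1) -> subm [set x | exists m, W m x].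
Proof.
move=> sW Wm; split; first by exists 0%N; apply: subm0.
move=> a x y [m mx] [n ny]; exists (maxn m n); apply: (sW _).2.
  by apply: chain_le mx => //; rewrite leq_maxl.
by apply: chain_le ny => //; rewrite leq_maxr.
Qed.

(** A recursive form of the span of a list, suited to splitting off one generator at a time. *)
Fixpoint lcomb (s : seq M) : set M :=
  if s is x :: s' then [set a *: x + u | a in setT & u in lcomb s']
  else [set 0].

Lemma subm_lcomb s : subm (lcomb s).
Proof.
elim: s => [|x s [IH0 IH]] /=; first by split=> // a x y -> ->;
  rewrite scaler0 addr0.
split; first by exists 0 => //; exists 0; rewrite ?scale0r ?addr0.
move=> a _ _ [b _ [u su <-]] [c _ [v sv <-]].
exists (a * b + c) => //; exists (a *: u + v); first exact: IH.
by rewrite scalerDl scalerDr scalerA addrACA.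
Qed.

Lemma mem_lcomb s x : x \in s -> lcomb s x.
Proof.
elim: s => // z s IH; rewrite inE => /orP[/eqP->|/IH sx] /=.
  by exists 1 => //; exists 0; [exact: subm0 (subm_lcomb _)|rewrite scale1r addr0].
by exists 0 => //; exists x; rewrite ?scale0r ?add0r.
Qed.

Lemma lcomb_sub s K : subm K -> (forall x, x \in s -> K x) -> lcomb s `<=` K.
Proof.
move=> sK; elim: s => [_ x ->|z s IH Ks]; first exact: subm0.
move=> _ [a _ [u su <-]]; apply: sK.2; first by apply: Ks; rewrite mem_head.
by apply: IH su => x sx; apply: Ks; rewrite inE sx orbT.
Qed.

Lemma lspan_sub (A : set M) K x :
  subm K -> A `<=` K -> x \in lspan A -> K x.
Proof.
move=> sK AK /asboolP[n [a [v [Av ->]]]].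
by apply: subm_sum => // i _; apply: submZ => //; apply: AK.
Qed.

Lemma mem_lspan (A : set M) x : A x -> x \in lspan A.
Proof.
move=> Ax; apply/asboolP; exists 1%N, (fun=> 1), (fun=> x).
by rewrite big_ord1 scale1r.
Qed.

Lemma subm_submodClosed (K : submodClosed M) : subm [set x | x \in K].
Proof. by split=> [|a x y /= Kx Ky]; rewrite /= ?rpred0// rpredD// rpredZ. Qed.

End Submodules.

(** The union of a chain is an ideal, and its finitely many generators all lie in one member of the
    chain. *)
Lemma acc_ideal (R : comPzRingType) : noetherian R -> acc (@subm R R^o).
Proof.
move=> nR W sW Wm; have [J0 JP] := subm_chain sW Wm.
pose P : {pred R^o} := fun x => `[< exists m, W m x >].
have Pc : submod_closed P.
  split; first exact/asboolP.
  by move=> a x y /asboolP Px /asboolP Py; apply/asboolP/JP.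
pose PC := HB.pack_for (submodClosed R^o) P (GRing.isSubmodClosed.Build R R^o P Pc).
have [s sP] := nR PC.
have [k kP] : exists k, forall x, x \in s -> W k x.
  have : forall x, x \in s -> exists m, W m x.
    by move=> x xs; apply/asboolP; rewrite -/(P x) -[P x]/(x \in PC) sP;
      apply: mem_lspan.
  elim: s {sP} => [|x s IH] sW'; first by exists 0%N.
  have [m mx] := sW' x (mem_head _ _).
  have [|k kP] := IH; first by move=> z zs; apply: sW'; rewrite inE zs orbT.
  exists (maxn m k) => z; rewrite inE => /orP[/eqP ->|/kP].
    by apply: chain_le mx => //; rewrite leq_maxl.
  by apply: chain_le => //; rewrite leq_maxr.
exists k => m km x mx.
have : x \in PC by apply/asboolP; exists m.
by rewrite sP; apply: lspan_sub.
Qed.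

(** * Hilbert's basis theorem for families of submodules indexed by degree *)

Section HilbertBasis.
Variables (R : comPzRingType) (M : lmodType R).

(** Induction on the generators: a submodule of R x + [lcomb s] is controlled by the ideal [J] of
    its coefficients of [x] together with its trace on [lcomb s], and both chains become
    stationary. *)
Lemma acc_lcomb : noetherian R ->
  forall s : seq M, acc [set K | subm K /\ K `<=` lcomb s].
Proof.
move=> nR; elim=> [|x s IH] W sW Wm.
  by exists 0%N => m _ z /(sW m).2 ->; apply: subm0; case: (sW 0%N).
pose J m : set R^o := [set a | exists2 u, lcomb s u & W m (a *: x + u)].
have sJ m : subm (J m).
  have [s0 sP] := subm_lcomb s; have [W0 WP] := (sW m).1.
  split; first by exists 0; rewrite ?scale0r ?addr0.
  move=> a b c [u su Wu] [v sv Wv]; exists (a *: u + v); first exact: sP.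
  by rewrite scalerDl -scalerA addrACA -scalerDr; apply: WP.
have [|k1 k1P] := acc_ideal nR sJ.
  by move=> m a [u su Wu]; exists u => //; apply: Wm.
have [||k2 k2P] := IH (fun m => W m `&` lcomb s).
- by move=> m; split; [apply: submI; [case: (sW m)|apply: subm_lcomb]|move=> z []].
- by move=> m z [/Wm].
exists (maxn k1 k2) => m; rewrite geq_max => /andP[k1m k2m] z mz.
have Wk := chain_le Wm.
have [a _ [u su zE]] := (sW m).2 _ mz; have : J m a by exists u; rewrite // zE.
move=> /(k1P _ k1m)[v sv /(Wk _ _ (leq_maxl k1 k2)) kv].
have : (W m `&` lcomb s) (z - (a *: x + v)).
  split; first by apply: (submB (sW m).1) => //; apply: Wk kv; rewrite geq_max k1m.
  by rewrite -zE opprD addrACA subrr add0r; apply: submB => //; apply: subm_lcomb.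
move=> /(k2P _ k2m)[/(Wk _ _ (leq_maxr k1 k2)) kz _].
by rewrite -[z](subrK (a *: x + v)); apply: submD (sW _).1 kz kv.
Qed.

(* A graded submodule of M[t], as the set of pairs (n, x) with x t^n in it. *)
Definition fam (ys : seq R) (B K : set (nat * M)) : Prop :=
  [/\ forall n, subm [set x | K (n, x)],
      forall y n x, y \in ys -> K (n, x) -> K (n.+1, y *: x)
    & K `<=` B].

(** The coefficient of [y ^+ i] has degree [m - i], so that every term has degree [m]. The truncated
    subtraction is harmless for [j <= m.+1], in particular in [adjoin_powers], where the exponents
    go up to the degree. *)
Definition powers_lt (y : R) (B : set (nat * M)) j m : set M :=
  [set x | exists2 b : nat -> M, forall i, (i < j)%N -> B ((m - i)%N, b i)
         & x = \sum_(i < j) y ^+ i *: b i].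

Definition adjoin_powers y B : set (nat * M) :=
  [set p | powers_lt y B p.1.+1 p.1 p.2].

Variables (ys : seq R) (B : set (nat * M)) (y : R).
Hypothesis famB : fam ys B B.

Lemma powers_ltS j m x : powers_lt y B j.+1 m x <->
  exists u z, [/\ B ((m - j)%N, u), powers_lt y B j m z & x = y ^+ j *: u + z].
Proof.
split=> [[b Bb ->]|[u [z [Bu [b Bb ->] ->]]]].
  exists (b j), (\sum_(i < j) y ^+ i *: b i); split;
    rewrite ?big_ord_recr 1?addrC//.
    exact: Bb.
  by exists b => // i ij; apply: Bb; rewrite ltnW.
exists (fun i => if i == j then u else b i) => [i|].
  by rewrite ltnS leq_eqVlt; case: eqP => [->//|_ /=]; apply: Bb.
rewrite big_ord_recr /= eqxx addrC; congr (_ + _); apply: eq_bigr => i _.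
by rewrite ltn_eqF.
Qed.

Lemma subm_powers_lt j m : subm (powers_lt y B j m).
Proof.
have [sB _ _] := famB; split.
  exists (fun=> 0) => [i _|]; first exact: (sB _).1.
  by rewrite big1 // => i _; rewrite scaler0.
move=> a _ _ [b Bb ->] [c Bc ->]; exists (fun i => a *: b i + c i) => [i ij|].
  by apply: (sB _).2; [apply: Bb|apply: Bc].
rewrite scaler_sumr -big_split; apply: eq_bigr => i _.
by rewrite scalerDr !scalerA mulrC.
Qed.

Lemma powers_lt_mul z j m x : (j <= m.+1)%N -> z \in ys ->
  powers_lt y B j m x -> powers_lt y B j m.+1 (z *: x).
Proof.
have [_ cB _] := famB; move=> jm zs [b Bb ->];
  exists (fun i => z *: b i) => [i ij|].
  by rewrite subSn; [apply/cB/Bb|rewrite -ltnS (leq_trans ij)].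
by rewrite scaler_sumr; apply: eq_bigr => i _; rewrite !scalerA mulrC.
Qed.

Lemma powers_lt_mulX j m x :
  powers_lt y B j m x -> powers_lt y B j.+1 m.+1 (y *: x).
Proof.
have [sB _ _] := famB; move=> [b Bb ->].
exists (fun i => if i is i'.+1 then b i' else 0) => [[_|i ij]|].
- exact: (sB _).1.
- by rewrite subSS; apply: Bb.
rewrite big_ord_recl scaler0 add0r scaler_sumr; apply: eq_bigr => i _.
by rewrite scalerA -exprS.
Qed.

Lemma fam_adjoin_powers : fam (y :: ys) (adjoin_powers y B) (adjoin_powers y B).
Proof.
split=> // [n|z n x]; first exact: subm_powers_lt.
rewrite inE => /orP[/eqP ->|zs]; first exact: powers_lt_mulX.
move=> nx; apply/powers_ltS; exists 0, (z *: x); split.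
- by have [sB _ _] := famB; apply: (sB _).1.
- exact: powers_lt_mul.
- by rewrite scaler0 add0r.
Qed.

(** The coefficients of [y ^+ j] in elements of [W] that otherwise involve only lower powers. As [y]
    acts on [M] and is no indeterminate, such an expression need not be unique; any one counts. *)
Let lead j (W : set (nat * M)) : set (nat * M) :=
  [set p | B p /\ exists2 z, powers_lt y B j (p.1 + j) z
                           & W ((p.1 + j)%N, y ^+ j *: p.2 + z)].

(* The leading coefficient argument of Hilbert's basis theorem. *)
Lemma acc_adjoin_powers : acc (fam ys B) ->
  acc (fam (y :: ys) (adjoin_powers y B)).
Proof.
have [sB cB _] := famB; move=> accB W fW Wm.
have sW m n : subm [set x | W m (n, x)] by case: (fW m).
have cW m z n x : z \in y :: ys -> W m (n, x) -> W m (n.+1, z *: x).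
  by case: (fW m) => _ + _; apply.
have flead m j : fam ys B (lead j (W m)).
  split=> [n|z n x zs /= [Bx [w jw Ww]]|p []//].
    split=> [|a x x' /= [Bx [w jw Ww]] [Bx' [w' jw' Ww']]].
      split; first exact: (sB _).1.
      exists 0; first exact: subm0 (subm_powers_lt _ _).
      by rewrite scaler0 addr0; apply: (sW _ _).1.
    split; first exact: (sB _).2.
    exists (a *: w + w'); first exact: (subm_powers_lt _ _).2.
    have := (sW _ _).2 a _ _ Ww Ww' => /=.
    by rewrite scalerDr addrACA scalerA mulrC -scalerA -scalerDr.
  split; first exact: cB.
  exists (z *: w); first by rewrite addSn; apply: powers_lt_mul => //;
    apply/leqW/leq_addl.
  by rewrite scalerA mulrC -scalerA -scalerDr addSn; apply: cW;
    rewrite // inE zs orbT.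
(* The sets [lead j (W m)] increase in [m] and in [j], so a single [k] serves all [j]. *)
have [||k kP] := acc_double accB flead.
- by move=> m j [n x] [Bx [w jw /Wm Ww]]; split=> //; exists w.
- move=> m j [n x] [/= Bx [w jw Ww]]; split=> //; exists (y *: w).
    by rewrite /= addnS; apply: powers_lt_mulX.
  by rewrite /= addnS exprS -scalerA -scalerDr; apply: cW; rewrite // mem_head.
exists k => m km [n x] mx.
(* Induction on the number [j] of powers: subtracting an element of [W k] with the same leading
   coefficient leaves an element with fewer powers. *)
suff key j x' : (j <= n.+1)%N -> powers_lt y B j n x' -> W m (n, x') -> W k (n, x').
  by apply: (key n.+1) => //; case: (fW m) => _ _ /(_ _ mx).
elim: j x' {x mx} => [|j IH] x jn jx mx.
  by case: jx => b _ ->; rewrite big_ord0; apply: (sW k n).1.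
have {jx}[u [z [Bu jz xE]]] := (powers_ltS _ _ _).1 jx.
have nj : (n - j + j)%N = n by rewrite subnK.
have : lead j (W m) ((n - j)%N, u) by split=> //; exists z; rewrite /= nj// -xE.
move=> /(kP _ _ km)[_ [z' /=]]; rewrite nj => jz' kz'.
have mz : W m (n, z - z').
  have := submB (sW m n) mx (chain_le Wm km kz') => /=.
  by rewrite xE opprD addrACA subrr add0r.
have kz : W k (n, z - z').
  by apply: IH => //; [rewrite ltnW|apply: submB => //; apply: subm_powers_lt].
have := submD (sW k n) kz' kz => /=.
by rewrite -addrA [z' + _]addrC subrK -xE.
Qed.

End HilbertBasis.

(** Start with [lcomb s] in degree 0 and zero in all other degrees, then adjoin the [ys] one at a
    time. Closure under [ys] puts all products of [n] of them with elements of [lcomb s] into degree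
    [n] of [B]. *)
Lemma acc_rees (R : comPzRingType) (M : lmodType R) (s : seq M) (ys : seq R) :
  noetherian R ->
  exists B, [/\ fam ys B B, acc (fam ys B) & forall x, lcomb s x -> B (0%N, x)].
Proof.
move=> nR; elim: ys => [|y ys [B [fB aB B0]]]; last first.
  exists (adjoin_powers y B); split; first exact: fam_adjoin_powers.
    exact: acc_adjoin_powers.
  move=> x /B0 Bx; exists (fun=> x) => [i|]; first by rewrite ltnS leqn0 => /eqP ->.
  by rewrite big_ord1 scale1r.
exists [set p | if p.1 is 0%N then lcomb s p.2 else p.2 = 0]; split=> //.
  split=> // -[|n]; first exact: subm_lcomb.
  by split=> //= a x y -> ->; rewrite scaler0 addr0.
move=> W fW Wm; have [||k kP] := acc_lcomb nR (s := s) (W := fun m =>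
  [set x | W m (0%N, x)]).
- by move=> m; case: (fW m) => sW _ WB; split=> // x /WB.
- by move=> m x; apply: Wm.
exists k => m km [[|n] x]; first exact: (kP m km x).
by case: (fW m) => _ _ WB /WB /= ->; case: (fW k) => + _ _ => /(_ n.+1)[].
Qed.

(** * The Artin-Rees lemma and its consequences for (0 :_M I) *)

Section ArtinRees.
Variables (R : comPzRingType) (c : nat) (y : 'I_c -> R).

Section Dilation.
Variable M : lmodType R.
Implicit Types (K N : set M) (x : M).

(* I K, for I generated by the y i *)
Definition dil K : set M :=
  [set x | exists2 z : 'I_c -> M, forall i, K (z i) & x = \sum_i y i *: z i].

Definition annih : set M := [set x | forall i, y i *: x = 0].

Lemma subm_dil K : subm K -> subm (dil K).
Proof.
move=> sK; split; first by exists (fun=> 0) => [i|];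
  [exact: sK.1|rewrite big1 // => i; rewrite scaler0].
move=> a _ _ [z Kz ->] [w Kw ->]; exists (fun i => a *: z i + w i) => [i|].
  exact: sK.2.
rewrite scaler_sumr -big_split; apply: eq_bigr => i _.
by rewrite scalerDr !scalerA mulrC.
Qed.

Lemma subm_iter_dil n K : subm K -> subm (iter n dil K).
Proof. by move=> sK; elim: n => //= n; apply: subm_dil. Qed.

Lemma dilS K K' : K `<=` K' -> dil K `<=` dil K'.
Proof. by move=> KK' _ [z Kz ->]; exists z => // i; apply: KK'. Qed.

Lemma iter_dilS n K K' : K `<=` K' -> iter n dil K `<=` iter n dil K'.
Proof. by move=> KK'; elim: n => //= n; apply: dilS. Qed.

Lemma dil_sub K K' : subm K' -> (forall i x, K x -> K' (y i *: x)) ->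
  dil K `<=` K'.
Proof. by move=> sK' KK' _ [z Kz ->]; apply: subm_sum => // i _; apply: KK'. Qed.

Lemma dil_mem K i x : subm K -> K x -> dil K (y i *: x).
Proof.
move=> sK Kx; exists (fun j => if j == i then x else 0) => [j|].
  by case: eqP => // _; apply: subm0.
by rewrite (bigD1 i) //= eqxx big1 ?addr0// => j /negPf->; rewrite scaler0.
Qed.

Lemma dil_subset K : subm K -> dil K `<=` K.
Proof. by move=> sK; apply: dil_sub => // i x; apply: submZ. Qed.

Lemma iter_dil_le m n K : subm K -> (m <= n)%N ->
  iter n dil K `<=` iter m dil K.
Proof.
move=> sK /subnK<-; elim: (n - m)%N => [|k IH] //; rewrite addSn iterS.
exact: subset_trans (dil_subset (subm_iter_dil _ sK)) IH.
Qed.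

Lemma subm_annih : subm annih.
Proof.
split=> [i|a x z ax az i]; first by rewrite scaler0.
by rewrite scalerDr scalerA mulrC -scalerA ax az scaler0 addr0.
Qed.

Lemma iter_dil_annih n K : K `<=` annih -> iter n.+1 dil K `<=` [set 0].
Proof.
move=> Ka; elim: n => [|n IH] _ [z /= Kz ->] /=; rewrite big1 // => i _.
  exact: Ka.
by rewrite (IH _ (Kz i)) scaler0.
Qed.

Variables (N : set M) (s : seq M).
Hypotheses (nR : noetherian R) (sN : subm N) (Ns : N `<=` lcomb s).

(** The family I^n N lies inside the one from [acc_rees] and inherits its chain condition. *)
Lemma acc_iter_dil :
  acc (fam (codom y) [set p | iter p.1 dil N p.2]).
Proof.
have [B [[sB cB _] accB B0]] := acc_rees s (codom y) nR.
apply: sub_acc accB => K [sK cK KN]; split=> // -[n x] /KN /=.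
elim: n x {K sK cK KN} => [|n IH] x; first by move=> /Ns /B0.
apply: (dil_sub (K' := [set x | B (n.+1, x)])) => [|i {}x /IH Bx] /=.
  exact: sB.
by apply: cB => //; apply: codom_f.
Qed.

(** [V m] is the subfamily generated by [W] in degrees up to [m]: in degree n it is W_n for n <= m
    and I^(n-m) W_m beyond. It grows with [m], hence becomes stationary at some [k]; degree n + k
    then compares W_(n+k) with I^n W_k. *)
Lemma artin_rees (W : nat -> set M) : (forall n, subm (W n)) ->
  (forall n, W n `<=` iter n dil N) ->
  (forall n i x, W n x -> W n.+1 (y i *: x)) ->
  exists k, forall n, W (n + k)%N `<=` iter n dil (W k).
Proof.
move=> sW WN cW.
pose V m : set (nat * M) :=
  [set p | iter (p.1 - m) dil (W (minn p.1 m)) p.2].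
have [||k kP] := acc_iter_dil (W := V).
- move=> m; rewrite /V; split=> [n|_ n x /codomP[i ->]|[n x]] /=.
  + exact: subm_iter_dil.
  + have [nm|] := boolP (n < m)%N.
      rewrite (minn_idPl nm) (minn_idPl (ltnW nm)).
      by move: (nm) (ltnW nm); rewrite -!subn_eq0 => /eqP-> /eqP->; apply: cW.
    rewrite -leqNgt => mn.
    rewrite (minn_idPr mn) (minn_idPr (leqW mn)) subSn// iterS.
    by move=> Wx; apply: dil_mem => //; apply: subm_iter_dil.
  + move=> Vx; have : iter (n - m) dil (iter (minn n m) dil N) x.
      exact: iter_dilS Vx.
    by rewrite -iterD minnE subnKC ?leq_subr.
- move=> m [n x]; rewrite /V /=; have [nm|] := boolP (n <= m)%N.
    by rewrite (minn_idPl nm) (minn_idPl (leqW nm)); move: (nm) (leqW nm);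
      rewrite -!subn_eq0 => /eqP-> /eqP->.
  rewrite -ltnNge => mn;
    rewrite (minn_idPr mn) (minn_idPr (ltnW mn)) -[(n - m)%N]prednK ?subn_gt0//
    -subnS.
  by rewrite iterSr; apply: iter_dilS; apply: dil_sub => // i z; apply: cW.
exists k => n x Wx.
have := kP (n + k)%N (leq_addl _ _) ((n + k)%N, x).
rewrite /V /= subnn minnn addnK (minn_idPr _) ?leq_addl//; exact.
Qed.

(** For n > k, Artin-Rees puts the intersection of I^n N and [annih] into a positive power of I
    times a part of [annih], which is zero. *)
Lemma annih_pow0 : exists n0, forall n x, (n0 <= n)%N ->
  iter n dil N x -> annih x -> x = 0.
Proof.
have [n|n x []//|n i x [Wx ax]|k kP] :=
  artin_rees (W := fun n => iter n dil N `&` annih).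
- by apply: submI; [apply: subm_iter_dil|apply: subm_annih].
- split; first by rewrite /=; apply: dil_mem => //; apply: subm_iter_dil.
  exact: (submZ _ (subm_annih) ax).
exists k.+1 => n x /subnK nk Nx ax; have := kP (n - k.+1).+1 x.
rewrite addSn -addnS nk => /(_ (conj Nx ax)).
by apply: iter_dil_annih => z [].
Qed.

End Dilation.

Variables (M : lmodType R) (N : set M) (s : seq M).
Hypotheses (nR : noetherian R) (sN : subm N) (Ns : N `<=` lcomb s).

(* Apply Artin-Rees to the image of M -> M^c, x |-> (y_i x)_i. *)
Lemma colon_pow : exists n0, forall n x, (n0 <= n)%N ->
  (forall i, iter n.+1 (dil (M := M)) N (y i *: x)) ->
  exists2 u, iter n (dil (M := M)) N u & annih (x - u).
Proof.
pose L : lmodType R := {ffun 'I_c -> M}.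
pose NL : set L := [set f | forall i, N (f i)].
pose phi (x : M) : L := [ffun i => y i *: x].
pose delta i (x : M) : L := [ffun j => if j == i then x else 0].
have phiP a x z : phi (a *: x + z) = a *: phi x + phi z.
  by apply/ffunP => i; rewrite !ffunE scalerDr !scalerA mulrC.
have sNL : subm NL.
  split=> [i|a f g Nf Ng i]; rewrite !ffunE; first exact: sN.1.
  exact: sN.2.
pose sL := [seq delta i x | i <- enum 'I_c, x <- s].
have NLs : NL `<=` lcomb sL.
  move=> f Nf; have -> : f = \sum_(i <- enum 'I_c) delta i (f i).
    apply/ffunP => j; rewrite big_enum sum_ffunE (bigD1 j) //= ffunE eqxx.
    by rewrite big1 ?addr0// => i /negPf; rewrite ffunE eq_sym => ->.
  apply: subm_sum => [|i _]; first exact: subm_lcomb.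
  have : lcomb s (f i) by apply: Ns.
  apply: (lcomb_sub (K := [set x | lcomb sL (delta i x)])) => [|x xs].
    have [L0 LP] := subm_lcomb sL.
    split=> [|a x z Lx Lz] /=.
      by have -> : delta i 0 = 0 by apply/ffunP => j; rewrite !ffunE if_same.
    have -> : delta i (a *: x + z) = a *: delta i x + delta i z; last exact: LP.
    by apply/ffunP => j; rewrite !ffunE; case: eqP; rewrite ?scaler0 ?addr0.
  by apply: mem_lcomb; apply/allpairsP; exists (i, x); rewrite mem_enum.
(* One half of the fact that I^n (N^c) is computed coordinatewise; [powL'] is the other half. *)
have powL n : forall f : L, (forall i, iter n (dil (M := M)) N (f i)) ->
    iter n (dil (M := L)) NL f.
  elim: n => // n IH f fP.
  have {fP}[z zP] : exists z : 'I_c -> 'I_c -> M, forall i,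
      (forall j, iter n (dil (M := M)) N (z i j)) /\ f i = \sum_j y j *: z i j.
    have /choice[z zP] i : exists z : 'I_c -> M,
      (forall j, iter n (dil (M := M)) N (z j)) /\ f i = \sum_j y j *: z j.
      by have [z zP ->] := fP i; exists z.
    by exists z.
  exists (fun j => [ffun i => z i j]) => [j|].
    by apply: IH => i; rewrite ffunE; apply: (zP i).1.
  apply/ffunP => i; rewrite sum_ffunE (zP i).2; apply: eq_bigr => j _.
  by rewrite !ffunE.
(* [Z n] is (I^n N :_M I). *)
pose Z n : set M := [set x | iter n (dil (M := L)) NL (phi x)].
have sZ n : subm (Z n).
  have [s0 sP] := subm_iter_dil n sNL.
  split=> [|a x z Zx Zz]; rewrite /Z /= ?phiP; last exact: sP.
  by have -> : phi 0 = 0 by apply/ffunP => i; rewrite !ffunE scaler0.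
pose W n : set L := [set phi x | x in Z n].
have [n|n _ [x Zx <-]//|n i _ [x Zx <-]|k kP] := artin_rees nR NLs (W := W).
- split; first by exists 0; [exact: (sZ n).1|apply/ffunP => i;
  rewrite !ffunE scaler0].
  by move=> a _ _ [x Zx <-] [z Zz <-]; exists (a *: x + z); [exact: (sZ n).2|].
- have phiZ : phi (y i *: x) = y i *: phi x.
    by apply/ffunP => j; rewrite !ffunE !scalerA mulrC.
  exists (y i *: x) => //; rewrite /Z /= phiZ; apply: dil_mem => //.
  exact: subm_iter_dil.
exists k => n x kn Ix.
have : W n.+1 (phi x) by exists x => //; apply: powL => i; rewrite ffunE.
have phi_dil m :
    iter m (dil (M := L)) (W k) `<=` phi @` iter m (dil (M := M)) (Z k).
  elim: m => // m IH _ [z zW ->].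
  have /choice[w wP] i : exists v, iter m (dil (M := M)) (Z k) v /\ phi v = z i.
    by have [v] := IH _ (zW i); exists v.
  exists (\sum_i y i *: w i); first by exists w => // i; apply: (wP i).1.
  apply/ffunP => j; rewrite sum_ffunE ffunE scaler_sumr; apply: eq_bigr => i _.
  by rewrite -(wP i).2 !ffunE !scalerA mulrC.
have powL' m : forall f : L, iter m (dil (M := L)) NL f ->
    forall i, iter m (dil (M := M)) N (f i).
  elim: m => [f //|m IH _ [z zW ->] i]; exists (fun j => z j i) => [j|].
    exact: IH (zW j) i.
  by rewrite sum_ffunE; apply: eq_bigr => j _; rewrite ffunE.
(* Artin-Rees gives u in I^(n+1-k) Z_k with the same image as x. One factor I moves Z_k into I^k N,
   so u lies in I^n N; equality of the images means that I kills x - u. *)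
rewrite -[n.+1](subnK (leqW kn)) => /kP/phi_dil[u Zu phiu]; exists u.
  move: Zu; rewrite subSn// iterSr -[in X in _ -> X](subnK kn) iterD.
  apply: iter_dilS; apply: dil_sub => [|i z /powL' /(_ i)]; last by rewrite ffunE.
  exact: subm_iter_dil.
move=> i; have /ffunP/(_ i) := phiu; rewrite !ffunE scalerBr => ->.
exact: subrr.
Qed.

End ArtinRees.

(** * Homogeneous components and associated primes *)

Section Components.
Variables (J : eqType) (V : zmodType) (g : J -> set V).

(* h j x is the component of x of degree j. *)
Definition components (h : J -> V -> V) : Prop :=
  [/\ forall j x, g j (h j x),
      forall j x z, h j (x - z) = h j x - h j z,
      forall i j x, g j x -> h i x = if i == j then x else 0
    & forall x, exists s, [/\ uniq s, x = \sum_(j <- s) h j x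
                            & forall j, j \notin s -> h j x = 0]].

Lemma big_support_widen (s s' : seq J) (F : J -> V) : uniq s -> uniq s' ->
  {subset s <= s'} -> (forall j, j \notin s -> F j = 0) ->
  \sum_(j <- s) F j = \sum_(j <- s') F j.
Proof.
move=> us us' ss' F0; rewrite [RHS](bigID (mem s)) /= [X in _ + X]big1 ?addr0//.
rewrite -[RHS]big_filter; apply/perm_big/uniq_perm => //; first exact: filter_uniq.
by move=> j; rewrite mem_filter; case: (boolP (j \in s)) => // /ss'.
Qed.

(** Decompositions with finite support exist and are unique. Choosing one for each element gives the
    projections, which are additive by uniqueness. *)
Lemma direct_sum_components : direct_sum g -> exists h, components h.
Proof.
case=> g0 gsum guniq.
have g00 j : g j 0 by case: (g0 j).
have gB j x z : g j x -> g j z -> g j (x - z) by case: (g0 j) => _; apply.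
pose D x (F : J -> V) := (forall j, g j (F j)) /\ exists s : seq J,
  [/\ uniq s, x = \sum_(j <- s) F j & forall j, j \notin s -> F j = 0].
have DB x z F G : D x F -> D z G -> D (x - z) (fun j => F j - G j).
  move=> [gF [s [us -> F0]]] [gG [s' [us' -> G0]]]; split=> [j|]; first exact: gB.
  exists (undup (s ++ s')); rewrite undup_uniq sumrB; split=> // [|j].
    congr (_ - _); apply: big_support_widen; rewrite ?undup_uniq// => j js.
      by rewrite mem_undup mem_cat js.
    by rewrite mem_undup mem_cat js orbT.
  by rewrite mem_undup mem_cat negb_or => /andP[/F0-> /G0->]; rewrite subr0.
have Dg j x : g j x -> D x (fun i => if i == j then x else 0).
  move=> gx; split=> [i|]; first by case: eqP => // ->.
  exists [:: j]; split=> // [|i]; first by rewrite big_seq1 eqxx.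
  by rewrite inE => /negPf->.
have D0 F : D 0 F -> forall j, F j = 0.
  move=> [gF [s [us s0 F0]]] j; case: (boolP (j \in s)) => [|/F0//].
  exact: guniq.
have Duniq x F G : D x F -> D x G -> forall j, F j = G j.
  move=> DF DG j; apply/eqP; rewrite -subr_eq0; apply/eqP.
  by apply: (D0 (fun j => F j - G j)); rewrite -(subrr x); apply: DB.
have Dex x : exists F, D x F.
  have [s [f [gf ->]]] := gsum x; elim: s => [|j s [F DF]].
    exists (fun=> 0); split=> //; exists [::]; split=> //; by rewrite !big_nil.
  (* [DB] provides differences only, so [f j] is added by subtracting its negative. *)
  have DN : D (- f j) (fun i => 0 - if i == j then f j else 0).
    rewrite -[- f j]sub0r; apply: (DB _ _ (fun=> 0)) (Dg _ _ (gf j)).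
    by split=> //; exists [::]; rewrite big_nil.
  by eexists; rewrite big_cons addrC -[f j]opprK; apply: (DB _ _ _ _ DF DN).
have /choice[H HP] := Dex; exists (fun j x => H x j); split.
- by move=> j x; case: (HP x).
- by move=> j x z; apply: (Duniq (x - z) _ _ (HP _) (DB _ _ _ _ (HP x) (HP z))).
- by move=> i j x gx; apply: (Duniq x _ _ _ (Dg j x gx)).
- by move=> x; case: (HP x).
Qed.

Variable h : J -> V -> V.
Hypothesis hP : components h.

Lemma comp_mem j x : g j (h j x). Proof. by case: hP. Qed.

Lemma compB j : {morph h j : x z / x - z}.
Proof. by case: hP => _ hB _ _ x z; apply: hB. Qed.

Lemma comp0 j : h j 0 = 0.
Proof. by rewrite -[X in h j X](subrr 0) compB subrr. Qed.

Lemma compN j : {morph h j : x / - x}.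
Proof. by move=> x; rewrite -sub0r compB comp0 sub0r. Qed.

Lemma compD j : {morph h j : x z / x + z}.
Proof. by move=> x z; rewrite -[z in LHS]opprK compB compN opprK. Qed.

Lemma comp_sum (K : Type) (s : seq K) (F : K -> V) j :
  h j (\sum_(k <- s) F k) = \sum_(k <- s) h j (F k).
Proof. exact: (big_morph _ (compD j) (comp0 j)). Qed.

Lemma comp_homog i j x : g j x -> h i x = if i == j then x else 0.
Proof. by case: hP => _ _ hh _; apply: hh. Qed.

Lemma comp_id j x : g j x -> h j x = x.
Proof. by move=> /(comp_homog j); rewrite eqxx. Qed.

Lemma comp_decomp x : exists s, [/\ uniq s, x = \sum_(j <- s) h j x
  & forall j, j \notin s -> h j x = 0].
Proof. by case: hP. Qed.

Lemma additive_ext (W : zmodType) (F G : V -> W) :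
  {morph F : x z / x + z} -> {morph G : x z / x + z} ->
  (forall j x, g j x -> F x = G x) -> F =1 G.
Proof.
move=> FD GD FG x; have [s [_ -> _]] := comp_decomp x.
have F0 : F 0 = 0 by apply: (addrI (F 0)); rewrite -FD !addr0.
have G0 : G 0 = 0 by apply: (addrI (G 0)); rewrite -GD !addr0.
rewrite (big_morph F FD F0) (big_morph G GD G0).
by apply: eq_bigr => j _; apply: FG (comp_mem j x).
Qed.

End Components.

Section Primes.
Variables (R : comPzRingType) (p : set R).
Hypothesis pS : Spec p.

Lemma primeM a b : p b -> p (a * b).
Proof. by move=> pb; case: pS => p0 pD _ _; rewrite -[_ * _]addr0; apply: pD. Qed.

Lemma primeD a b : p a -> p b -> p (a + b).
Proof. by move=> pa pb; case: pS => _ pD _ _; rewrite -[a]mul1r; apply: pD. Qed.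

Lemma primeB a b : p a -> p b -> p (a - b).
Proof. by move=> pa pb; rewrite -mulN1r; apply: primeD => //; apply: primeM. Qed.

Lemma notin_primeM a b : ~ p a -> ~ p b -> ~ p (a * b).
Proof. by move=> pa pb; case: pS => _ _ _ pP /pP[]. Qed.

Lemma notin_prime1 : ~ p 1. Proof. by case: pS. Qed.

Lemma primeX a n : p (a ^+ n) -> p a.
Proof.
elim: n => [|n IH]; first by move=> /notin_prime1.
by rewrite exprS; case: pS => _ _ _ pP /pP[].
Qed.

(** The product of the given elements stays outside the prime and lies in every [Q j]. *)
Lemma notin_prime_prod (J : eqType) (s : seq J) (Q : J -> set R) :
  (forall j a b, Q j b -> Q j (a * b)) ->
  (forall j, j \in s -> exists2 b, Q j b & ~ p b) ->
  exists2 b, (forall j, j \in s -> Q j b) & ~ p b.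
Proof.
move=> QM; elim: s => [_|j s IH Qs]; first by exists 1 => //; apply: notin_prime1.
have [b Qb pb] := Qs j (mem_head _ _).
have [|b' Qb' pb'] := IH; first by move=> i si; apply: Qs; rewrite inE si orbT.
exists (b' * b) => [i|]; last exact: notin_primeM.
rewrite inE => /orP[/eqP->|/Qb' Q']; first exact: QM.
by rewrite mulrC; apply: QM.
Qed.

End Primes.

Definition colon (R : comPzRingType) (M : lmodType R) (K : set M) (x : M) :
  set R := [set a | K (a *: x)].

(** * Graded submodules and homogeneity of associated primes *)

Section Graded.
Variables (R : comPzRingType) (gR : nat -> set R).
Variables (M : lmodType R) (gM : int -> set M).
Hypothesis M_graded : graded_module gR gM.
Variables (hR : nat -> R -> R) (h : int -> M -> M).
Hypotheses (hRP : components gR hR) (hP : components gM h).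
Implicit Types (K : set M) (x : M) (t : int).

Definition gsub K : Prop := forall x t, K x -> K (h t x).

Lemma gradedZ i j a x : gR i a -> gM j x -> gM (i%:Z + j) (a *: x).
Proof. by case: M_graded => _; apply. Qed.

Lemma comp_scale i t a x : gR i a -> h t (a *: x) = a *: h (t - i%:Z) x.
Proof.
move=> ga; move: x; apply: (additive_ext hP (F := fun x => h t (a *: x))
  (G := fun x => a *: h (t - i%:Z) x)) => [x z|x z|j x gx].
- by rewrite scalerDr (compD hP).
- by rewrite (compD hP) scalerDr.
rewrite (comp_homog hP _ gx) (comp_homog hP _ (gradedZ ga gx)).
by rewrite subr_eq addrC; case: eqP; rewrite ?scaler0.
Qed.

Lemma comp_scale_sum t a x (s : seq nat) : a = \sum_(i <- s) hR i a ->
  h t (a *: x) = \sum_(i <- s) hR i a *: h (t - i%:Z) x.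
Proof.
move=> aE; rewrite {1}aE scaler_suml (comp_sum hP); apply: eq_bigr => i _.
by rewrite (comp_scale _ _ (comp_mem hRP i a)).
Qed.

Lemma gsub_mem K x : subm K -> (forall t, K (h t x)) -> K x.
Proof. by move=> sK Kx; have [s [_ -> _]] := comp_decomp hP x; apply: subm_sum. Qed.

(* R is nonnegatively graded, so generators of degree > t do not contribute in
   degree t. *)
Lemma generator_degree (A : set (int * M)) (T : set M) t x : subm T ->
  (forall e z, A (e, z) -> gM e z) ->
  (forall K, subm K -> (forall e z, A (e, z) -> K z) -> K x) ->
  gM t x -> ~ T x -> exists e z, [/\ A (e, z), ~ T z & e <= t].
Proof.
move=> sT gA Ax gx nTx.
(* The conclusion is imposed on all components at once. This defines a submodule because homogeneous
   scalars never lower degrees. *)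
pose K : set M := [set x | forall t, ~ T (h t x) ->
  exists e z, [/\ A (e, z), ~ T z & e <= t]].
suff : K x by apply; rewrite (comp_id hP gx).
apply: Ax => [|e z Az t']; last first.
  rewrite (comp_homog hP _ (gA _ _ Az)); case: eqP => [->|_]; last by case: sT.
  by exists e, z.
split=> [t'|a z w Kz Kw t']; first by rewrite (comp0 hP); case: sT.
have [s [_ aE _]] := comp_decomp hRP a.
rewrite (compD hP) (comp_scale_sum _ _ aE) => nT.
have [/Kw//|Tw] := pselect (~ T (h t' w)).
apply: contrapT => none; apply: nT; apply: submD (contrapT Tw) => //.
apply: subm_sum => // i _; apply: submZ => //; apply: contrapT => nT; apply: none.
have [e [u [Au nTu et]]] := Kz _ nT; exists e, u; split=> //.
by apply: le_trans et _; rewrite gerBl.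
Qed.

Lemma seq_int_bounded (s : seq int) :
  exists l n, forall j, j \in s -> l <= j < l + n%:Z.
Proof.
elim: s => [|i s [l [n lP]]]; first by exists 0, 0%N.
exists (Num.min i l), (`|i| + `|l| + n).+1%N => j; rewrite inE.
by move=> /orP[/eqP->|/lP]; lia.
Qed.

Lemma comp_bounded x : exists l n, forall t, h t x != 0 -> l <= t < l + n%:Z.
Proof.
have [s [_ _ s0]] := comp_decomp hP x.
have [l [n lP]] := seq_int_bounded s; exists l, n => t ht.
by apply: lP; apply: contraNT ht => /s0->.
Qed.

Section HomogeneousPrime.
Variables (K : set M).
Hypotheses (sK : subm K) (gK : gsub K).

(** Induction on the length [n] of the window of degrees in which [x] has components outside [K]. In
    degree i0 + l, the element a x agrees modulo [K] with the product of the lowest components. So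
    multiplying [x] by [hR i0 a] moves its lowest component into [K] and shortens the window. *)
Lemma lowest_comp_nilpotent (a : R) (i0 : nat) :
  (forall i, (i < i0)%N -> hR i a = 0) -> forall n l x,
  (forall t, ~ K (h t x) -> l <= t < l + n%:Z) ->
  K (a *: x) -> exists m, K (hR i0 a ^+ m *: x).
Proof.
move=> a0; elim=> [|n IH] l x Kx Kax.
  exists 0%N; rewrite scale1r; apply: gsub_mem => // t.
  by apply: contrapT => /Kx; lia.
have ga := comp_mem hRP i0 a.
have Kl : K (hR i0 a *: h l x).
  have [s [us aE s0]] := comp_decomp hRP a.
  have := gK (i0%:Z + l) Kax; rewrite (comp_scale_sum _ _ aE).
  case: (boolP (i0 \in s)) => [i0s|/s0->]; last by rewrite scale0r => _; case: sK.
  rewrite (bigD1_seq i0) //= addrAC subrr add0r => Ksum.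
  rewrite -[X in K X](addrK (\sum_(i <- s | i != i0) hR i a *: h (i0%:Z + l - i%:Z)
    x)).
  apply: submB => //; rewrite -big_filter; apply: subm_sum => // i.
  rewrite mem_filter => /andP[ii0 _].
  have [/a0->|ii0'] := ltnP i i0; first by rewrite scale0r; case: sK.
  by apply: submZ => //; apply: contrapT => /Kx; lia.
have [||m mP] := IH (i0%:Z + l + 1) (hR i0 a *: x).
- move=> t; rewrite (comp_scale _ _ ga) => nK.
  have [tl|tl] := eqVneq (t - i0%:Z) l; first by rewrite tl in nK.
  have /Kx : ~ K (h (t - i0%:Z) x) by move=> ?; apply: nK; apply: submZ.
  by lia.
- by rewrite scalerA mulrC -scalerA; apply: submZ.
by exists m.+1; rewrite exprSr -scalerA.
Qed.

Variables (p : set R) (x : M).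
Hypotheses (pS : Spec p) (px : p = colon K x).

(** By [lowest_comp_nilpotent], a power of the lowest component of an element of [p] lies in [p],
    hence so does the component. Removing it and repeating reaches every degree; [b k] is [a]
    without its components of degree below [k]. *)
Lemma prime_colon_homogeneous a i : p a -> p (hR i a).
Proof.
have low i0 b : p b -> (forall i, (i < i0)%N -> hR i b = 0) -> p (hR i0 b).
  move=> pb b0; have [l [n lP]] := comp_bounded x.
  have [|t nK||m mP] := @lowest_comp_nilpotent b i0 _ n l x.
  - exact: b0.
  - by apply: lP; apply: contra_notN nK => /eqP->; case: sK.
  - by move: pb; rewrite px.
  by apply: (primeX pS (n := m)); rewrite px.
move=> pa; pose b i := a - \sum_(k < i) hR k a.
have hb k j : hR j (b k) = if (j < k)%N then 0 else hR j a.
  rewrite (compB hRP) (comp_sum hRP).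
  under eq_bigr => l _ do rewrite (comp_homog hRP _ (comp_mem hRP l a)).
  case: ltnP => jk; last first.
    by rewrite big1 ?subr0// => l _; case: eqP => // jl; have := ltn_ord l; lia.
  rewrite (bigD1 (Ordinal jk)) //= eqxx big1 ?addr0 ?subrr// => l.
  by rewrite -val_eqE /= eq_sym => /negPf->.
have pb : p (b i).
  elim: i => [|i IH]; first by rewrite /b big_ord0 subr0.
  rewrite /b big_ord_recr /= opprD addrA; apply: primeB => //.
  have -> : hR i a = hR i (b i) by rewrite hb ltnn.
  by apply: low => // j ji; rewrite hb ji.
have -> : hR i a = hR i (b i) by rewrite hb ltnn.
by apply: low => // j ji; rewrite hb ji.
Qed.

(** As [p] is homogeneous, it lies in the colon ideal of every component. If all these inclusions
    were strict, a product of elements outside [p] would carry every component, hence [x], into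
    [K]. *)
Lemma prime_colon_comp : exists t, p = colon K (h t x).
Proof.
have [s [_ xE _]] := comp_decomp hP x.
have psub t : p `<=` colon K (h t x).
  move=> a pa; have [sa [_ -> _]] := comp_decomp hRP a.
  rewrite /colon /= scaler_suml; apply: subm_sum => // i _.
  have := prime_colon_homogeneous i pa; rewrite px => /(gK (t + i%:Z)).
  by rewrite (comp_scale _ _ (comp_mem hRP i a)) addrK.
have [[t tp]|none] := pselect (exists t, colon K (h t x) `<=` p).
  by exists t; apply/seteqP.
have [||b bK pb] := notin_prime_prod pS (s := s) (Q := fun t => colon K (h t x)).
- by move=> j a b; rewrite /colon /= -scalerA; apply: submZ.
- move=> t _; apply: contrapT => H; apply: none; exists t => b Kb.
  by apply: contrapT => pb; apply: H; exists b.
exfalso; apply: pb; rewrite px /colon /= xE scaler_sumr.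
exact: subm_sum.
Qed.

End HomogeneousPrime.

Section Generators.
Variables (c : nat) (y : 'I_c -> R) (d : 'I_c -> nat).
Hypothesis yd : forall i, gR (d i) (y i).

Lemma gsub_dil K : gsub K -> gsub (dil y K).
Proof.
move=> gK _ t [z Kz ->]; exists (fun i => h (t - (d i)%:Z) (z i)) => [i|].
  exact: gK.
by rewrite (comp_sum hP); apply: eq_bigr => i _; rewrite (comp_scale _ _ (yd i)).
Qed.

Lemma gsub_iter_dil n K : gsub K -> gsub (iter n (dil y (M := M)) K).
Proof. by move=> gK; elim: n => //= n; apply: gsub_dil. Qed.

Lemma gsub_annih : gsub (annih y (M := M)).
Proof.
move=> x t ax i; have := ax i => /(congr1 (h (t + (d i)%:Z))).
by rewrite (comp_scale _ _ (yd i)) addrK (comp0 hP).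
Qed.

Definition degree_ge e : set M := [set x | forall t, t < e -> h t x = 0].

Lemma subm_degree_ge e : subm (degree_ge e).
Proof.
split=> [t _|a x z ex ez t te]; first exact: comp0 hP _.
have [s [_ aE _]] := comp_decomp hRP a.
rewrite (compD hP) (comp_scale_sum _ _ aE) ez// addr0 big1// => i _.
by rewrite ex ?scaler0//; lia.
Qed.

Lemma lcomb_degree_ge (s : seq M) : exists e, lcomb s `<=` degree_ge e.
Proof.
suff [e eP] : exists e, forall x, x \in s -> degree_ge e x.
  by exists e; apply: lcomb_sub => //; apply: subm_degree_ge.
elim: s => [|x s [e eP]]; first by exists 0.
have [l [n lP]] := comp_bounded x; exists (Num.min l e) => z.
rewrite inE => /orP[/eqP->|/eP ez] t te; last by apply: ez; lia.
by apply/eqP; apply: contraLR te => /lP; lia.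
Qed.

Lemma iter_dil_degree_ge K e n : (forall i, 1 <= d i)%N -> K `<=` degree_ge e ->
  iter n (dil y (M := M)) K `<=` degree_ge (e + n%:Z).
Proof.
move=> d1 Ke; elim: n => [|n IH]; first by rewrite addr0.
apply: dil_sub => [|i x /IH Kx t te]; first exact: subm_degree_ge.
by rewrite (comp_scale _ _ (yd i)) Kx ?scaler0//; have := d1 i; lia.
Qed.

End Generators.

End Graded.

(** * Minima of finitely many linear functions *)

Section EventuallyMinLinear.
Variables (c : nat) (d : 'I_c -> nat).
Implicit Types (S : nat -> set int) (L : seq ('I_c * int)).

Definition lin (q : 'I_c * int) (n : nat) : int := (d q.1)%:Z * n%:Z + q.2.

(* For n >> 0, the infimum of S n is the minimum of the lin q n, q in L; the
   list L may be empty. *)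
Definition ev_min_lin S : Prop := exists L n0, forall n, (n0 <= n)%N ->
  (forall q, q \in L -> exists2 t, S n t & t <= lin q n) /\
  (forall t, S n t -> exists2 q, q \in L & lin q n <= t).

Lemma ev_min_lin0 S n0 : (forall n t, (n0 <= n)%N -> ~ S n t) -> ev_min_lin S.
Proof. by move=> S0; exists [::], n0 => n n0n; split=> // t /(S0 _ _ n0n). Qed.

Lemma ev_min_linU S S' : ev_min_lin S -> ev_min_lin S' ->
  ev_min_lin (fun n => S n `|` S' n).
Proof.
move=> [L [n0 LP]] [L' [n0' LP']]; exists (L ++ L'), (maxn n0 n0') => n.
rewrite geq_max => /andP[/LP[SL LS] /LP'[SL' LS']]; split=> [q|t].
  rewrite mem_cat => /orP[/SL|/SL'] [t St tq]; exists t => //; first by left.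
  by right.
by case=> [/LS|/LS'] [q qL qt]; exists q => //; rewrite mem_cat qL ?orbT.
Qed.

Lemma ev_min_lin_bigcup (J : eqType) (s : seq J) (S : J -> nat -> set int) :
  (forall j, j \in s -> ev_min_lin (S j)) ->
  ev_min_lin (fun n => [set t | exists2 j, j \in s & S j n t]).
Proof.
elim: s => [|j s IH] Ss; first by apply: (@ev_min_lin0 _ 0%N) => n t _ [].
have Sj := ev_min_linU (Ss j (mem_head _ _)) (IH (fun i si =>
  Ss i (@mem_behead _ (j :: s) i si))).
have [L [n0 LP]] := Sj; exists L, n0 => n /LP[SL LS];
  split=> [q /SL[t St tq]|t [i]].
  exists t => //; case: St => [Sjt|[i si Sit]]; first by exists j;
    rewrite ?mem_head.
  by exists i; rewrite // inE si orbT.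
rewrite inE => /orP[/eqP->|si] St; apply: LS; first by left.
by right; exists i.
Qed.

(** Lower bounds alone matter, so it suffices to treat a subset with an element below each given
    degree. *)
Lemma ev_min_lin_cofinal S S' n0 : ev_min_lin S' ->
  (forall n, (n0 <= n)%N -> S' n `<=` S n /\
     forall t, S n t -> exists2 t', S' n t' & t' <= t) ->
  ev_min_lin S.
Proof.
move=> [L [n1 LP]] SS'; exists L, (maxn n0 n1) => n.
rewrite geq_max => /andP[/SS'[sub dom] /LP[SL LS]]; split=> [q /SL[t St tq]|t].
  by exists t => //; apply: sub.
by move=> /dom[t' /LS[q qL qt'] t't]; exists q => //; apply: le_trans t't.
Qed.

(** The least slope wins, and among equal slopes the least intercept. Distinct slopes differ by at
    least 1, so the distance of the intercepts is a sufficient threshold. *)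
Lemma lin_min L : L != [::] -> exists q n0, q \in L /\
  forall n q', (n0 <= n)%N -> q' \in L -> lin q n <= lin q' n.
Proof.
elim: L => // q L IH _; have [->|/IH[q1 [n0 [q1L q1P]]]] := eqVneq L [::].
  by exists q, 0%N; split=> [|n q' _]; rewrite inE // => /eqP->.
have [|] := boolP ((d q.1 < d q1.1)%N || (d q.1 == d q1.1) && (q.2 <= q1.2)) => qq1.
  exists q, (maxn n0 `|q.2 - q1.2|%N); split=> [|n q']; first by rewrite mem_head.
  rewrite geq_max inE => /andP[n0n nq] /orP[/eqP->//|q'L].
  apply: le_trans (q1P n q' n0n q'L); rewrite /lin.
  by move: qq1 nq; case: q => [i b]; case: q1 {q1L q1P} => [j b'] /=; nia.
exists q1, (maxn n0 `|q.2 - q1.2|%N); split=> [|n q'];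
  first by rewrite inE q1L orbT.
rewrite geq_max inE => /andP[n0n nq] /orP[/eqP->|/q1P//]; last exact.
by move: qq1 nq; rewrite /lin; case: q => [i b]; case: q1 {q1L q1P} => [j b'] /=;
  nia.
Qed.

(** A single nonempty [S n] beyond the threshold forces [L] to be nonempty, and [lin_min] then
    selects the function. *)
Lemma ev_min_lin_nonempty S : ev_min_lin S ->
  (forall n0, exists2 n, (n0 <= n)%N & S n !=set0) ->
  exists i b n0, forall n, (n0 <= n)%N ->
    S n ((d i)%:Z * n%:Z + b) /\ forall t, S n t -> (d i)%:Z * n%:Z + b <= t.
Proof.
move=> [L [n0 LP]] /(_ n0)[n1 n01 [t1 /(LP n1 n01).2[q1 q1L _]]].
have [|q [n2 [qL qP]]] := @lin_min L; first by case: L q1L {LP}.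
exists q.1, q.2, (maxn n0 n2) => n.
rewrite geq_max -/(lin q n) => /andP[/LP[SL LS] n2n].
have Sq t : S n t -> lin q n <= t.
  by move=> /LS[q' q'L]; apply: le_trans; apply: qP.
split=> //; have [t St tq] := SL q qL.
by have <- : t = lin q n by apply/le_anti; rewrite tq Sq.
Qed.

(** * Degrees of monomials with exponents in a downward closed set *)

Section Monomials.
Implicit Types (a b : {ffun 'I_c -> nat}) (F : {set 'I_c}).
Variables (C : set {ffun 'I_c -> nat}) (k : nat) (e : int).

(* the translated face b + N^F *)
Definition face b F : set {ffun 'I_c -> nat} :=
  [set a | (forall i, (b i <= a i)%N) /\ forall i, i \notin F -> a i = b i].

(** The expected degrees of the products y^a w in I^n N, for w homogeneous of degree [e] in I^k
    N. *)
Definition degrees (X : set {ffun 'I_c -> nat}) n : set int :=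
  [set t | exists a, [/\ X a, (\sum_(i < c) a i + k)%N = n
                       & t = e + \sum_(i < c) (d i)%:Z * (a i)%:Z]].

(** For empty [F] only one total exponent occurs. Otherwise the cheapest choice spends the whole
    excess over [b] on a direction [i0] of [F] with least [d]. *)
Lemma ev_min_lin_face b F : ev_min_lin (degrees (face b F)).
Proof.
have [->|[i1 i1F]] := set_0Vmem F.
  apply: (@ev_min_lin0 _ (\sum_(i < c) b i + k).+1) => n _ bn [a [ab an _]].
  suff E : (\sum_(i < c) a i = \sum_(i < c) b i)%N by rewrite -an E ltnn in bn.
  by apply: eq_bigr => i _; apply: ab.2; rewrite inE.
pose i0 := [arg min_(i < i1 in F) d i].
have [i0F i0P] : i0 \in F /\ forall i, i \in F -> (d i0 <= d i)%N.
  by rewrite /i0; case: arg_minnP.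
pose b0 : int := \sum_(i < c) (d i)%:Z * (b i)%:Z.
(* The value at n is e + b0 + d_(i0) (n - |b| - k), as n - |b| - k factors remain free. *)
exists [:: (i0, e + b0 - (d i0)%:Z * (\sum_(i < c) b i + k)%:Z)],
  (\sum_(i < c) b i + k)%N.
move=> n bn; split=> [q|_ [a [ab an ->]]].
  rewrite inE => /eqP->.
  pose m i := if i == i0 then (n - (\sum_(i < c) b i + k))%N else 0%N.
  pose a := [ffun i => b i + m i]%N.
  have aE : (\sum_(i < c) a i = \sum_(i < c) b i + (n - (\sum_(i < c) b i + k)))%N.
    rewrite (eq_bigr (fun i => b i + m i)%N) => [|i _]; last by rewrite ffunE.
    by rewrite big_split /= -big_mkcond /= big_pred1_eq.
  exists (e + \sum_(i < c) (d i)%:Z * (a i)%:Z).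
    exists a; split=> //; last by rewrite aE; lia.
    split=> i; rewrite ffunE; first exact: leq_addr.
    by rewrite /m; case: eqP => [->|]; rewrite ?i0F ?addn0.
  rewrite (eq_bigr (fun i => (d i)%:Z * (b i)%:Z + (d i)%:Z * (m i)%:Z));
    last first.
    by move=> i _; rewrite ffunE PoszD mulrDr.
  rewrite big_split /= -/b0 [X in b0 + X](bigD1 i0) //=
    [X in _ + (_ + (_ + X))]big1.
    by rewrite /lin /m /= eqxx -subzn// mulrBr; lia.
  by move=> i /negPf ii0; rewrite /m ii0 mulr0.
exists (i0, e + b0 - (d i0)%:Z * (\sum_(i < c) b i + k)%:Z);
  first by rewrite mem_head.
have [ba abF] := ab.
suff : (d i0)%:Z * (\sum_(i < c) (a i - b i)%N)%:Z <=
    \sum_(i < c) (d i)%:Z * (a i - b i)%N%:Z.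
  have -> : \sum_(i < c) (d i)%:Z * (a i - b i)%N%:Z =
      \sum_(i < c) (d i)%:Z * (a i)%:Z - b0.
    by rewrite -sumrB; apply: eq_bigr => i _; rewrite -subzn// mulrBr.
  have -> : (\sum_(i < c) (a i - b i))%N%:Z =
      (\sum_(i < c) a i)%N%:Z - (\sum_(i < c) b i)%N%:Z.
    by rewrite sumnB// subzn// leq_sum.
  rewrite /lin /= -an !PoszD -subr_ge0 => le0.
  by rewrite -subr_ge0; apply: le_trans le0 _; rewrite le_eqVlt; apply/orP; left;
    apply/eqP; ring.
rewrite -[X in _ * X]natz natr_sum mulr_sumr; apply: ler_sum => i _; rewrite natz.
have [/i0P di|/abF->] := boolP (i \in F); last by rewrite subnn !mulr0.
by rewrite ler_wpM2r.
Qed.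

Hypothesis C_down : forall a b, (forall i, (a i <= b i)%N) -> C b -> C a.

(* If b + N^F is not contained in C, some a in it is not in C; the elements of C
   in b + N^F then have a coordinate in F less than that of a. *)
Lemma ev_min_lin_down b F : ev_min_lin (degrees (face b F `&` C)).
Proof.
have [m] := ubnP #|F|; elim: m b F => // m IH b F Fm.
have [FC|/existsNP[a /not_implyP[Fa nCa]]] := pselect (face b F `<=` C).
  by rewrite (setIidl FC); apply: ev_min_lin_face.
(* Each pair (i, l) freezes coordinate [i] at a value [l] with b_i <= l < a_i, which leaves a face
   with one direction fewer. *)
pose s := [seq (i, l) | i <- enum F, l <- iota (b i) (a i - b i)].
pose b' (q : 'I_c * nat) := [ffun j => if j == q.1 then q.2 else b j].
have /ev_min_lin_bigcup : forall q, q \in s ->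
    ev_min_lin (degrees (face (b' q) (F :\ q.1) `&` C)).
  move=> q /allpairsPdep[i [l [iF _ ->]]]; apply: IH; move: Fm.
  by rewrite (cardsD1 i F) -mem_enum iF.
move=> cup; apply: (ev_min_lin_cofinal (n0 := 0%N) cup) => n _.
split=> [t [q qs [a' [[Fa' Ca'] a'n ->]]]|_ [a' [[Fa' Ca'] a'n ->]]].
  move: qs Fa' => /allpairsPdep[i [l [iF li ->]]] [bF Fb].
  move: iF li; rewrite mem_enum mem_iota => iF /andP[bl _].
  exists a'; split=> //; split=> //; split=> j.
    by have := bF j; rewrite ffunE /=; case: eqP => // ->; apply: leq_trans.
  move=> jF; rewrite Fb; last by rewrite !inE negb_and jF orbT.
  by rewrite ffunE /=; case: eqP jF => // ->; rewrite iF.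
eexists; last exact: lexx.
have [i iF ia] : exists2 i, i \in F & (a' i < a i)%N.
  apply: contrapT => none; apply: nCa; apply: C_down Ca' => j.
  rewrite leqNgt; apply/negP => ja; apply: none; exists j => //.
  by apply: contraT => jF; rewrite Fa.2// Fa'.2// ltnn in ja.
exists (i, a' i).
  apply/allpairsPdep; exists i, (a' i); rewrite mem_enum mem_iota; split=> //.
  by rewrite Fa'.1 subnKC ?Fa.1.
exists a'; split=> //; split=> //; split=> j; rewrite ?inE ffunE /=.
  by case: eqP => [->//|_]; apply: Fa'.1.
by case: eqP => [->//|_]; apply: Fa'.2.
Qed.

Lemma ev_min_lin_degrees : ev_min_lin (degrees C).
Proof.
have := ev_min_lin_down [ffun=> 0%N] [set: 'I_c]%SET.
congr ev_min_lin; apply/funext => n; congr degrees; apply/seteqP;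
  split=> [a []//|a Ca].
by split=> //; split=> i; rewrite ?inE ?ffunE.
Qed.

End Monomials.
End EventuallyMinLinear.

(** * Local degrees of I^(n-1) N / I^n N *)

Section NoetherianModule.
Variables (R : comPzRingType) (M : lmodType R) (s : seq M).
Hypothesis nR : noetherian R.

(** A maximal one among the spans of finite lists in [K] absorbs every further element of [K]. *)
Lemma noetherian_fg (K : set M) : subm K -> K `<=` lcomb s ->
  exists2 s', forall x, x \in s' -> K x & K `<=` lcomb s'.
Proof.
move=> sK Ks.
pose X := [set U | exists2 s', forall x, x \in s' -> K x & U = lcomb s'].
have [_ [s' Ks' ->] s'max] : exists2 U, X U & forall U',
  X U' -> U `<=` U' -> U' `<=` U.
  apply: acc_max (acc_lcomb nR (s := s)) _ _ => [_ [s' Ks' ->]|].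
    split; first exact: subm_lcomb.
    by apply: subset_trans Ks; apply: lcomb_sub.
  by exists (lcomb [::]), [::].
exists s' => // x Kx; apply: (s'max (lcomb (x :: s'))) => [|z s'z|].
- by exists (x :: s') => // z; rewrite inE => /orP[/eqP->|/Ks'].
- by exists 0 => //; exists z; rewrite ?scale0r ?add0r.
by apply: mem_lcomb; rewrite mem_head.
Qed.

End NoetherianModule.

Section Monomials.
Variables (R : comPzRingType) (M : lmodType R) (c : nat) (y : 'I_c -> R).
Implicit Types (a b : {ffun 'I_c -> nat}).

Definition mon a : R := \prod_(i < c) y i ^+ a i.

Lemma mon0 : mon [ffun=> 0%N] = 1.
Proof. by rewrite /mon big1 // => i _; rewrite ffunE expr0. Qed.

Lemma monD a b : mon [ffun i => (a i + b i)%N] = mon a * mon b.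
Proof. by rewrite /mon -big_split; apply: eq_bigr => i _; rewrite ffunE exprD. Qed.

Lemma monS a (i : 'I_c) : mon [ffun j => (a j + (j == i))%N] = y i * mon a.
Proof.
rewrite mulrC -[in RHS](_ : mon [ffun j => nat_of_bool (j == i)] = y i).
  by rewrite -monD; congr mon; apply/ffunP => j; rewrite !ffunE.
rewrite /mon (bigD1 i) //= big1 ?mulr1 => [|j /negPf ji].
  by rewrite ffunE eqxx expr1.
by rewrite ffunE ji expr0.
Qed.

Lemma mon_stable (V : nat -> set M) a n x :
  (forall n i x, V n x -> V n.+1 (y i *: x)) -> V n x ->
  V (\sum_(i < c) a i + n)%N (mon a *: x).
Proof.
move=> cV; rewrite /mon; elim: (index_enum _) n x => [|i r IH] n x Vx.
  by rewrite !big_nil scale1r.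
rewrite !big_cons [(a i + _)%N]addnC -addnA mulrC -scalerA.
apply: IH; elim: (a i) => [|m Vm]; first by rewrite scale1r.
by rewrite exprS -scalerA; apply: cV.
Qed.

(** The products y^a w span I^m K. Quantifying over [K'] lets the induction pass to the preimage of
    [K'] under multiplication by [y i]. *)
Lemma iter_dil_mon (K K' : set M) (ws : seq M) m x : K `<=` lcomb ws ->
  subm K' ->
  (forall w a, w \in ws -> (\sum_(i < c) a i)%N = m -> K' (mon a *: w)) ->
  iter m (dil y (M := M)) K x -> K' x.
Proof.
move=> Kws; elim: m K' x => [|m IH] K' x sK' K'ws.
  move=> /Kws; apply: lcomb_sub => // w ww; rewrite -[w]scale1r -mon0.
  by apply: K'ws => //; rewrite big1 // => i _; rewrite ffunE.
apply: dil_sub => // i z; apply: (IH [set z | K' (y i *: z)]).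
  split=> [|a u v Ku Kv] /=; first by rewrite scaler0; case: sK'.
  by rewrite scalerDr scalerA mulrC -scalerA; apply: sK'.2.
move=> w a ww am /=; rewrite scalerA -monS; apply: K'ws => //.
under eq_bigr => j _ do rewrite ffunE.
by rewrite big_split /= am -big_mkcond /= big_pred1_eq addn1.
Qed.

End Monomials.

Section AssociatedGraded.
Variables (R : comPzRingType) (M : lmodType R) (c : nat) (y : 'I_c -> R).
Variables (N : set M) (s : seq M).
Hypotheses (nR : noetherian R) (sN : subm N) (Ns : N `<=` lcomb s).

Local Notation P n := (iter n (dil y (M := M)) N).

Lemma colon_subm (K : set M) x : subm K -> subm (colon K x : set R^o).
Proof.
move=> sK; split=> [|a b b' Kb Kb']; rewrite /colon /=.
  by rewrite scale0r; case: sK.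
by rewrite scalerDl -scalerA; apply: sK.2.
Qed.

Lemma colon_prime_scale (K : set M) x a : Spec (colon K x) ->
  ~ colon K x a -> subm K -> colon K (a *: x) = colon K x.
Proof.
move=> pS na sK; apply/seteqP; split=> b; rewrite /colon /= scalerA => Kb.
  by case: pS => _ _ _ /(_ b a Kb)[].
by rewrite mulrC -scalerA; apply: submZ.
Qed.

(* Filter by families K_0 < K_1 < ... such that each quotient has a single
   annihilator: enlarge K by the elements killed by a maximal annihilator. *)
Lemma finitely_many_primes : exists ps : seq (set R), forall n x,
  P n x -> Spec (colon (P n.+1) x) -> colon (P n.+1) x \in ps.
Proof.
pose B : set (nat * M) := [set q | P q.1 q.2].
pose sec (K : set (nat * M)) n : set M := [set x | K (n, x)].
pose Q (K : set (nat * M)) := exists ps : seq (set R), forall n x,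
  P n x -> Spec (colon (sec K n) x) -> colon (sec K n) x \in ps.
have sP n : subm (P n) by apply: subm_iter_dil.
suff : Q [set q | P q.1.+1 q.2] by [].
apply: (acc_ind (D := fam (codom y) B)); first exact: acc_iter_dil nR Ns.
  move=> K [sK cK KB] IH.
  pose X : set (set R^o) := [set J | exists n x,
    [/\ P n x, ~ K (n, x) & J = colon (sec K n) x]].
  have [X0|X0] := pselect (X !=set0); last first.
    exists [::] => n x Px pS; exfalso; apply: X0; exists (colon (sec K n) x), n, x.
    split=> // Kx; apply: (notin_prime1 pS); rewrite /colon /= scale1r; exact: Kx.
  have [_ [n0 [x0 [Px0 Kx0 ->]]] pmax] : exists2 J, X J &
      forall J', X J' -> J `<=` J' -> J' `<=` J.
    apply: acc_max (acc_ideal nR) _ X0 => _ [n [x [_ _ ->]]].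
    exact: colon_subm (sK n).
  pose p := colon (sec K n0) x0.
  pose K' : set (nat * M) := [set q | P q.1 q.2 /\ forall a, p a -> K (q.1,
    a *: q.2)].
  have [|||ps psP] := IH K'.
  - split=> [n|_ n x /codomP[i ->] [Px Kx]|q []//].
      split=> [|a x z [Px Kx] [Pz Kz]]; split=> /=.
      + exact: (sP n).1.
      + by move=> a _; rewrite scaler0; apply: (sK n).1.
      + exact: (sP n).2.
      + move=> b pb; rewrite scalerDr scalerA mulrC -scalerA.
        by apply: (sK n).2; [apply: Kx|apply: Kz].
    split=> /=; first exact: dil_mem.
    move=> a pa; rewrite scalerA mulrC -scalerA; apply: cK; first exact: codom_f.
    exact: Kx.
  - by move=> [n x] Kx; split; [exact: KB Kx|move=> a _;
    exact: (submZ a (sK n) Kx)].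
  - by move=> /(_ (n0, x0)) K'K; apply: Kx0; apply: K'K; split.
  exists (p :: ps) => n x Px qS; rewrite inE; apply/orP.
  (* If some multiple of [x] lies in [K'] but not in [K], its annihilator modulo [K] contains [p],
     so equals [p] by maximality. Otherwise [x] has the same annihilator modulo [K] and [K'], and
     the list for [K'] applies. *)
  have [[a [K'a Ka]]|none] := pselect (exists a, K' (n, a *: x) /\ ~ K (n, a *: x)).
    left; apply/eqP; rewrite -(colon_prime_scale (a := a) qS Ka (sK n)).
    have pa : p `<=` colon (sec K n) (a *: x) by move=> b /K'a.2.
    apply/seteqP; split=> //; apply: pmax => //; exists n, (a *: x).
    by split=> //; apply: submZ.
  right; have E : colon (sec K' n) x = colon (sec K n) x.
    apply/seteqP; split=> a Ka.
      by apply: contrapT => nKa; apply: none; exists a.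
    split=> [|b _] /=; first exact: submZ.
    exact: (submZ b (sK n) Ka).
  by rewrite -E; apply: psP => //; rewrite E.
split=> [n|_ n x /codomP[i ->]|[n x]] /=; first exact: (sP n.+1).
  by apply: dil_mem; apply: (sP n.+1).
exact: (iter_dil_le sN (leqnSn n)).
Qed.

Variables (gR : nat -> set R) (gM : int -> set M).
Hypothesis M_graded : graded_module gR gM.
Variables (hR : nat -> R -> R) (h : int -> M -> M).
Hypotheses (hRP : components gR hR) (hP : components gM h).
Variable d : 'I_c -> nat.
Hypotheses (yd : forall i, gR (d i) (y i)) (gN : gsub h N).

Lemma mon_homogeneous (a : {ffun 'I_c -> nat}) e x : gM e x ->
  gM (e + \sum_(i < c) (d i)%:Z * (a i)%:Z) (mon y a *: x).
Proof.
rewrite /mon; elim: (index_enum _) e x => [|i r IH] e x gx.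
  by rewrite !big_nil addr0 scale1r.
rewrite !big_cons addrA [X in X *: _]mulrC -scalerA; apply: IH;
  elim: (a i) => [|m gm].
  by rewrite mulr0 addr0 scale1r.
rewrite exprS -scalerA.
have -> : e + (d i)%:Z * m.+1%:Z = (d i)%:Z + (e + (d i)%:Z * m%:Z).
  by rewrite -addn1 PoszD mulrDr mulr1 addrA addrC.
exact: (gradedZ M_graded (yd i) gm).
Qed.

Lemma homogeneous_generators (K : set M) (s' : seq M) : gsub h K ->
  (forall x, x \in s' -> K x) -> exists ws : seq (int * M),
    (forall w, w \in ws -> gM w.1 w.2 /\ K w.2) /\
    lcomb s' `<=` lcomb [seq w.2 | w <- ws].
Proof.
move=> gK; elim: s' => [|x s' IH] Ks'; first by exists [::]; split.
have [|ws [wsP ws_s']] := IH; first by move=> z zs; apply: Ks'; rewrite inE zs orbT.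
have [r [_ xE _]] := comp_decomp hP x.
pose ws' := [seq (t, h t x) | t <- r] ++ ws.
exists ws'; split=> [w|].
  rewrite mem_cat => /orP[/mapP[t _ ->]|/wsP//]; split;
    first exact: comp_mem hP _ _.
  by apply: gK; apply: Ks'; rewrite mem_head.
apply: lcomb_sub => [|z]; first exact: subm_lcomb.
rewrite inE => /orP[/eqP->|zs'].
  rewrite xE; apply: subm_sum => [|t tr]; first exact: subm_lcomb.
  apply: mem_lcomb; apply/mapP; exists (t, h t x) => //.
  by rewrite mem_cat map_f.
apply: (lcomb_sub (s := [seq w.2 | w <- ws]) (subm_lcomb _)) => [u /mapP[w ww ->]|].
  by apply: mem_lcomb; apply: map_f; rewrite mem_cat ww orbT.
by apply: ws_s'; apply: mem_lcomb.
Qed.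

(* the degrees of the homogeneous elements of I^n N / I^(n+1) N with
   annihilator p *)
Definition grdeg (p : set R) n : set int :=
  [set t | exists x, [/\ P n x, gM t x & p = colon (P n.+1) x]].

Lemma ev_min_lin_grdeg p : Spec p -> ev_min_lin d (grdeg p).
Proof.
move=> pS.
(* A witness in some degree makes [p] homogeneous, which is used to show that the [W n] are
   graded. *)
have [[n1 [t1 [x1 [Px1 gx1 px1]]]]|none] := pselect (exists n, grdeg p n !=set0);
  last first.
  by apply: (@ev_min_lin0 _ _ _ 0%N) => n t _ St; apply: none; exists n, t.
have sP n : subm (P n) by apply: subm_iter_dil.
have gP n : gsub h (P n) by apply: (gsub_iter_dil M_graded hP yd).
have phom a i : p a -> p (hR i a).
  exact: (prime_colon_homogeneous M_graded hRP hP (sP _) (gP _) pS px1).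
have dP n i x : P n x -> P n.+1 (y i *: x) by apply: dil_mem (sP n).
pose W n := [set x | P n x /\ forall a, p a -> P n.+1 (a *: x)].
pose T n := [set x | exists2 a, ~ p a & P n.+1 (a *: x)].
have sW n : subm (W n).
  split=> [|a x z [Px Wx] [Pz Wz]].
    by split=> [|a _]; rewrite ?scaler0; [exact: (sP n).1|exact: (sP n.+1).1].
  split=> [|b pb]; first exact: (sP n).2.
  rewrite scalerDr scalerA mulrC -scalerA.
  by apply: (sP n.+1).2; [apply: Wx|apply: Wz].
have sT n : subm (T n).
  split=> [|a x z [b pb Px] [b' pb' Pz]].
    by exists 1; [exact: notin_prime1|rewrite scaler0; exact: (sP n.+1).1].
  exists (b * b'); first exact: notin_primeM.
  have -> : (b * b') *: (a *: x + z) = (b' * a) *: (b *: x) + b *: (b' *: z).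
    by rewrite scalerDr !scalerA [b * b']mulrC mulrAC.
  exact: (sP n.+1).2 _ _ _ Px (submZ b (sP n.+1) Pz).
have cW n i x : W n x -> W n.+1 (y i *: x).
  move=> [Px Wx]; split; first exact: dP.
  by move=> a /Wx Pa; rewrite scalerA mulrC -scalerA; apply: dP.
have cT n i x : T n x -> T n.+1 (y i *: x).
  by move=> [a pa Px]; exists a => //; rewrite scalerA mulrC -scalerA; apply: dP.
have gW n : gsub h (W n).
  move=> x t [Px Wx]; split=> [|a pa]; first exact: gP.
  have [r [_ -> _]] := comp_decomp hRP a.
  rewrite scaler_suml; apply: subm_sum => // i _.
  have := gP n.+1 _ (t + i%:Z) (Wx _ (phom a i pa)).
  by rewrite (comp_scale M_graded hP _ _ (comp_mem hRP i a)) addrK.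
have [n x []//|k kP] := artin_rees nR Ns sW _ cW.
have Wks : W k `<=` lcomb s.
  by move=> x [/(iter_dil_le sN (leq0n k)) /Ns].
have [s' Ws' s'W] := noetherian_fg nR (sW k) Wks.
have [ws [wsP ws_s']] := homogeneous_generators (gW k) Ws'.
have {s'W ws_s' Ws'}Wws := subset_trans s'W ws_s'.
pose C (w : M) : set {ffun 'I_c -> nat} :=
  [set a : {ffun 'I_c -> nat} | ~ T (\sum_(i < c) a i + k)%N (mon y a *: w)].
have C_down (w : M) (a b : {ffun 'I_c -> nat}) : (forall i : 'I_c,
  (a i <= b i)%N) -> C w b -> C w a.
  move=> ab Cb Ta; apply: Cb; pose e := [ffun i => (b i - a i)%N].
  have := mon_stable e cT Ta; rewrite scalerA -monD addnA -big_split /=.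
  have -> : [ffun i => (e i + a i)%N] = b by apply/ffunP => i; rewrite !ffunE subnK.
  by under eq_bigr => i _ do rewrite ffunE subnK//.
have := ev_min_lin_bigcup (s := ws) (fun w _ =>
  ev_min_lin_degrees d k w.1 (@C_down w.2)).
(* A product y^a w in W_n outside T_n has annihilator exactly [p]; it remains to find such a product
   in degree at most that of a given witness. *)
move=> /(ev_min_lin_cofinal (n0 := k)); apply => n kn; split.
  move=> _ [w /wsP[gw Ww] [a [Ca an ->]]]; exists (mon y a *: w.2).
  have := mon_stable a cW Ww; move: Ca; rewrite /C /= an => Ta [Pa Wa].
  split=> //; first exact: mon_homogeneous.
  apply/seteqP; split=> [b /Wa//|b Pb].
  by apply: contrapT => pb; apply: Ta; exists b.
move=> t [x [Px gx px]].
have Wx : W n x by split=> // a; rewrite px.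
have nTx : ~ T n x by move=> [a]; rewrite px.
(* By Artin-Rees these products span W_n, so [generator_degree] yields one outside T_n of no larger
   degree. *)
pose A : set (int * M) := [set q | exists w (a : {ffun 'I_c -> nat}), [/\ w \in ws,
  (\sum_(i < c) a i + k)%N = n, q.1 = w.1 + \sum_(i < c) (d i)%:Z * (a i)%:Z
  & q.2 = mon y a *: w.2]].
have [e z [w [a [ww _ /= -> ->]]]|K sK AK|e [z [[w [a [ww an /= eE zE]]] nTz et]]]
  :=
  generator_degree M_graded hRP hP (A := A) (sT n) _ _ gx nTx.
- by apply: mon_homogeneous; case: (wsP w ww).
- have := kP (n - k)%N x; rewrite subnK// => /(_ Wx).
  apply: (iter_dil_mon Wws sK) => _ a /mapP[w ww ->] an.
  by apply: AK; exists w, a; split=> //; rewrite an subnK.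
exists e => //; exists w => //; exists a; split=> //.
by rewrite /C /= an -zE.
Qed.

End AssociatedGraded.

(** * Vasconcelos numbers as infima of degrees *)

Section Infimum.
Implicit Types (S : set int) (A : set (\bar int)).

(** The integers in [A] are absent, unbounded below, or bounded below; in the last case there is a
    least one by well-ordering. *)
Lemma ebar_infimums A : A !=set0 -> infimums A !=set0.
Proof.
move=> [a0 Aa0].
have [ninf|nninf] := pselect (A -oo%E).
  by exists -oo%E; split=> [a _|l lA]; [exact: leNye|exact: lA].
have [[r0 Ar0]|none] := pselect (exists r : int, A r%:E%E); last first.
  exists +oo%E; split=> [a Aa|l _]; last exact: leey.
  by case: a Aa => // r Ar; exfalso; apply: none; exists r.
have [[l lA]|unb] := pselect (exists l : int, forall r : int, A r%:E%E -> l <= r);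
  last first.
  exists -oo%E; split=> [a _|l lA]; first exact: leNye.
  case: l lA => // [l|] lA; last by have := lA _ Ar0.
  by exfalso; apply: unb; exists l => r /lA; rewrite lee_fin.
have ex : exists k, `[< A (l + k%:Z)%:E%E >].
  exists `|r0 - l|%N; apply/asboolP; have := lA _ Ar0 => lr0.
  by have -> : l + `|r0 - l|%N%:Z = r0 by lia.
case: (ex_minnP ex) => k /asboolP Ak kmin; exists (l + k%:Z)%:E%E;
  split=> [[r||] Aa //|e eA].
- rewrite lee_fin; have lr := lA _ Aa; have := kmin `|r - l|%N.
  have -> : l + `|r - l|%N%:Z = r by lia.
  by move=> /(_ (asboolT Aa)); lia.
- exact: leey.
- exact: eA.
Qed.

Lemma infimum_lbound A a : A a -> (infimum +oo%E A <= a)%E.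
Proof. by move=> Aa; apply: le_infimum_Nmem => //; apply: ebar_infimums;
  exists a. Qed.

Lemma le_infimum A l : (forall a, A a -> (l <= a)%E) -> (l <= infimum +oo%E A)%E.
Proof.
move=> lA; rewrite /infimum; case: ifPn => [_|/set0P/ebar_infimums[i iA]].
  exact: leey.
by case: xgetP => [x _ [_ ub]|/(_ i)//]; apply: ub.
Qed.

Definition einf S : \bar int := infimum +oo%E [set t%:E%E | t in S].

Lemma einf_lbound S t : S t -> (einf S <= t%:E)%E.
Proof. by move=> St; apply: infimum_lbound; exists t. Qed.

Lemma le_einf S l : (forall t, S t -> (l <= t%:E)%E) -> (l <= einf S)%E.
Proof. by move=> lS; apply: le_infimum => _ [t St <-]; apply: lS. Qed.

Lemma einf_min S t : S t -> (forall t', S t' -> t <= t') -> einf S = t%:E%E.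
Proof.
move=> St tS; apply/le_anti; rewrite einf_lbound//=.
by apply: le_einf => t' /tS; rewrite lee_fin.
Qed.

Lemma einfS S S' : S `<=` S' -> (einf S' <= einf S)%E.
Proof. by move=> SS'; apply: le_einf => t /SS'; apply: einf_lbound. Qed.

(** Lets (0 :_M I) alone determine the infimum once the degrees from I^(n-1) N / I^n N are large. *)
Lemma einfU S S' t0 : S' t0 -> (forall t, S t -> t0 <= t) ->
  einf (S `|` S') = einf S'.
Proof.
move=> S't0 t0S; apply/le_anti/andP; split; first by apply: einfS => t; right.
apply: le_einf => t [/t0S t0t|]; last exact: einf_lbound.
by apply: le_trans (einf_lbound S't0) _; rewrite lee_fin.
Qed.

Variables (R : comPzRingType) (L : lmodType R) (gL : int -> set L).

Lemma v_localE p : v_local gL p = einf [set t | exists2 x, gL t x & p = ann x].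
Proof. by []. Qed.

(** The nested infima merge into one over all homogeneous elements with prime annihilator. *)
Lemma v_numberE :
  v_number gL = einf [set t | exists2 x, gL t x & Spec (ann x)].
Proof.
apply/le_anti/andP; split.
  apply: le_einf => t [x gx xS].
  apply: le_trans (infimum_lbound (a := v_local gL (ann x)) _) _.
    by exists (ann x) => //; split=> //; exists x.
  by apply: einf_lbound; exists x.
apply: le_infimum => _ [p [pS _] <-]; apply: le_einf => t [x gx px].
by apply: einf_lbound; exists x; rewrite // -px.
Qed.

End Infimum.

Lemma ann_quotmod (R : comPzRingType) (M : lmodType R) (U : submodClosed M) x :
  ann (quotmod_pi U x : quotmod U) = colon [set z | z \in U] x.
Proof.
have E a : (a *: (quotmod_pi U x : quotmod U)) = quotmod_pi U (a *: x).
  exact: quotmod_piZ.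
have E0 : (0 : quotmod U) = quotmod_pi U 0.
  by have := E 0; rewrite !scale0r.
apply/seteqP; split=> a; rewrite /ann /colon /= E E0.
  by move=> /quotmod_eq; rewrite subr0.
by move=> Ux; apply/quotmod_eq; rewrite subr0.
Qed.

(** * From the quotient modules to colon ideals in [M] *)

Section Translation.
Variables (R : comPzRingType) (M : lmodType R) (gM : int -> set M).

(** The condition [X] is equality with [p] for the local invariant and [Spec] for the global one. *)
Lemma quotmod_degrees (U : submodClosed M) (X : set R -> Prop) :
  [set t | exists2 x, quotmod_grading gM U t x & X (ann x)] =
  [set t | exists2 x, gM t x & X (colon [set z | z \in U] x)].
Proof.
apply/seteqP; split=> t.
  by move=> [_ [x gx <-]]; rewrite ann_quotmod => Xx; exists x.
move=> [x gx Xx]; exists (quotmod_pi U x); first by exists x.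
by rewrite ann_quotmod.
Qed.

Lemma subquot_ann (U W : submodClosed M) (x : submod U) :
  ann (quotmod_pi (submod_trace U W) x : subquot U W) =
  colon [set z | z \in W] (val x).
Proof.
transitivity (colon [set z | z \in submod_trace U W] x); first exact: ann_quotmod.
apply/seteqP; split=> a; rewrite /colon /=.
  by move=> aW; have : val (a *: x) \in W by []; rewrite linearZ.
by move=> aW; have : val (a *: x) \in W by rewrite linearZ.
Qed.

Lemma subquot_degrees (U W : submodClosed M) (X : set R -> Prop) :
  [set t | exists2 x, subquot_grading gM U W t x & X (ann x)] =
  [set t | exists x, [/\ x \in U, gM t x & X (colon [set z | z \in W] x)]].
Proof.
apply/seteqP; split=> t.
  move=> [_ [x gx <-]]; rewrite subquot_ann => Xx; exists (val x); split=> //.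
  exact: valP.
move=> [x [Ux gx Xx]]; pose x' : submod U := Sub x Ux.
by exists (quotmod_pi (submod_trace U W) x'); [exists x'|rewrite subquot_ann].
Qed.

Lemma submod_ann (U : submodClosed M) (x : submod U) : ann x = colon [set 0] (val
  x).
Proof.
apply/seteqP; split=> a; rewrite /ann /colon /=.
  by move=> /(congr1 val); rewrite linearZ.
by move=> ax; apply: val_inj; rewrite linearZ.
Qed.

Lemma submod_degrees (U : submodClosed M) (X : set R -> Prop) :
  [set t | exists2 x, submod_grading gM U t x & X (ann x)] =
  [set t | exists x, [/\ x \in U, gM t x & X (colon [set 0] x)]].
Proof.
apply/seteqP; split=> t.
  move=> [x gx]; rewrite submod_ann => Xx; exists (val x); split=> //.
  exact: valP.
move=> [x [Ux gx Xx]]; exists (Sub x Ux) => //.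
by rewrite submod_ann.
Qed.

Variables (c : nat) (y : 'I_c -> R) (N : submodClosed M) (I : submodClosed R^o).
Hypothesis I_gen : (I : {pred R^o}) =i lspan (range y : set R^o).

Lemma mem_I i : y i \in I.
Proof. by rewrite I_gen; apply: mem_lspan; exists i. Qed.

Lemma I_sub (K : set R) : subm (K : set R^o) -> (forall i, K (y i)) ->
  forall a, a \in I -> K a.
Proof.
move=> sK Ky a; rewrite I_gen; apply: lspan_sub => // _ [i _ <-]; exact: Ky.
Qed.

(** Amounts to (I I^n) N = I (I^n N), with the generators [y i] in place of I. *)
Lemma mem_powN n x :
  x \in powN N I n <-> iter n (dil y (M := M)) [set x | x \in N] x.
Proof.
elim: n x => [|n IH] x.
  split=> [|Nx]; last first.
    by apply: mem_lspan; exists 1, x; split=> //; rewrite scale1r.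
  apply: lspan_sub => [|_ [a [u [_ Nu ->]]]]; first exact: subm_submodClosed.
  exact: submZ (subm_submodClosed N) Nu.
have sP m : subm (iter m (dil y (M := M)) [set x | x \in N]).
  by apply: subm_iter_dil; apply: subm_submodClosed.
split.
  apply: lspan_sub => [|_ [a [u [Ia Nu ->]]]]; first exact: (sP n.+1).
  move: a Ia.
  have sK : subm ([set a | iter n.+1 (dil y (M :=
    M)) [set x | x \in N] (a *: u)] : set R^o).
    split=> [|a b b' Kb Kb'] /=; first by rewrite scale0r; apply: (sP n.+1).1.
    by rewrite scalerDl -scalerA; apply: (sP n.+1).2.
  move=> a Ia; apply: (lspan_sub sK _ Ia) => _ [{Ia}a' [b [Ia Ib ->]]].
  apply: (I_sub (K := [set a | iter n.+1 (dil y (M :=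
    M)) [set x | x \in N] ((a * b) *: u)]) _ _ Ia).
    split=> [|b1 b2 b3 Kb2 Kb3] /=; first by rewrite mul0r scale0r;
      apply: (sP n.+1).1.
    by rewrite mulrDl scalerDl -mulrA -scalerA; apply: (sP n.+1).2.
  move=> i; rewrite /= -scalerA; apply: dil_mem; first exact: sP.
  by apply/IH; apply: mem_lspan; exists b, u.
apply: (dil_sub (K' := [set z | z \in powN N I n.+1])) => [|i z /IH];
  first exact: (subm_submodClosed (powN N I n.+1)).
apply: (lspan_sub (K := [set z | y i *: z \in powN N I n.+1])) =>
  [|_ [a [u [Ia Nu ->]]]].
  split=> [|a u v /= Ku Kv]; first by rewrite /= scaler0 rpred0.
  by rewrite scalerDr scalerA mulrC -scalerA rpredD// rpredZ.
rewrite /= scalerA; apply: mem_lspan; exists (y i * a), u; split=> //.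
by apply: mem_lspan; exists (y i), a; split=> //; apply: mem_I.
Qed.

Lemma mem_colon0 x : x \in colon0 M I <-> annih y x.
Proof.
split=> [/asboolP Ix i|yx]; first exact/Ix/mem_I.
apply/asboolP; apply: I_sub => //; split=> [|a b b' /= bx b'x] /=.
  by rewrite scale0r.
by rewrite scalerDl -scalerA bx b'x scaler0 addr0.
Qed.

End Translation.

Lemma near_infty (Q : nat -> Prop) :
  (\forall n \near \oo, Q n) <-> exists n0, forall n, (n0 <= n)%N -> Q n.
Proof. by split=> [[n0 _ n0P]|[n0 n0P]]; exists n0. Qed.

(** * Splitting and asymptotics of the sets of degrees *)

Section Degrees.
Variables (R : comPzRingType) (M : lmodType R) (c : nat) (y : 'I_c -> R).
Variables (N : set M) (s : seq M).
Hypotheses (nR : noetherian R) (sN : subm N) (Ns : N `<=` lcomb s).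
Variables (gR : nat -> set R) (gM : int -> set M).
Hypothesis M_graded : graded_module gR gM.
Variables (hR : nat -> R -> R) (h : int -> M -> M).
Hypotheses (hRP : components gR hR) (hP : components gM h).
Variable d : 'I_c -> nat.
Hypotheses (yd : forall i, gR (d i) (y i)) (gN : gsub h N).
Implicit Types X : set (set R).

Local Notation P n := (iter n (dil y (M := M)) N).

(* Degrees of the homogeneous elements of M / I^n N, of I^(n-1) N / I^n N and of
   (0 : I) whose annihilator is in X. *)
Definition degM X n : set int :=
  [set t | exists2 x, gM t x & X (colon (P n) x)].
Definition deggr X n : set int :=
  [set t | exists x, [/\ P n.-1 x, gM t x & X (colon (P n) x)]].
Definition degcolon X : set int :=
  [set t | exists x, [/\ annih y x, gM t x & X (colon [set 0] x)]].

Let sP n : subm (P n). Proof. exact: subm_iter_dil. Qed.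
Let gP n : gsub h (P n). Proof. exact: (gsub_iter_dil M_graded hP yd gN). Qed.

(** If the annihilator of x contains I, then [colon_pow] writes x as u' + z' with u' in I^(n-1) N
    and z' in (0 :_M I). As the sum is direct, the annihilator of x is the intersection of those of
    u' and z'; being prime, it equals one of them. *)
Lemma degM_split : exists n0, forall n X, (n0 <= n)%N ->
  (forall q, X q -> Spec q /\ forall i, q (y i)) ->
  degM X n = deggr X n `|` degcolon X.
Proof.
have [n0 n0P] := colon_pow y nR sN Ns.
have [n1 n1P] := annih_pow0 y nR sN Ns.
exists (maxn n0 n1).+1 => -[//|n] X; rewrite ltnS geq_max => /andP[n0n n1n] XS.
have PS : P n.+1 `<=` P n by apply: iter_dil_le.
apply/seteqP; split=> t; last first.
  case=> -[x [xP gx Xx]]; first by exists x.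
  exists x => //; have -> // : colon (P n.+1) x = colon [set 0] x.
  apply/seteqP; split=> a; rewrite /colon /=.
    move=> Pax; apply: (n1P n.+1); [exact: leqW|exact: Pax|].
    exact: (submZ a (@subm_annih _ _ y M) xP).
  by move=> ->; apply: (sP n.+1).1.
move=> [x gx Xx]; have [qS qy] := XS _ Xx.
have [u Pu zu] := n0P n x n0n qy.
pose u' := h t u; pose z' := h t (x - u).
have Pu' : P n u' by apply: gP.
have yz' : annih y z' by apply: (gsub_annih M_graded hP yd).
have gu' : gM t u' := comp_mem hP t u; have gz' : gM t z' := comp_mem hP t _.
have xE : x = u' + z'.
  by rewrite /z' (compB hP) (comp_id hP gx) addrC subrK.
have qE a : colon (P n.+1) x a <-> colon (P n.+1) u' a /\ colon [set 0] z' a.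
  rewrite /colon /=; split=> [Pax|[Pau az0]]; last first.
    by rewrite xE scalerDr az0 addr0.
  have az0 : a *: z' = 0.
    apply: (n1P n) => //; last exact: (submZ a (@subm_annih _ _ y M) yz').
    have -> : a *: z' = a *: x - a *: u' by rewrite xE scalerDr addrAC subrr add0r.
    exact: (submB (sP n) (PS _ Pax) (submZ a (sP n) Pu')).
  by split=> //; move: Pax; rewrite xE scalerDr az0 addr0.
have [sub|/existsNP[b /not_implyP[bu nb]]] :=
  pselect (colon (P n.+1) u' `<=` colon (P n.+1) x).
  left; exists u'; split=> //; have <- // : colon (P n.+1) x = colon (P n.+1) u'.
  by apply/seteqP; split=> // a /qE[].
right; exists z'; split=> //; have <- // : colon (P n.+1) x = colon [set 0] z'.
apply/seteqP; split=> a; first by move=> /qE[].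
move=> az0; case: (qS) => _ _ _ /(_ a b)[]//.
apply/qE; split; rewrite /colon /= -scalerA.
  exact: (submZ a (sP n.+1) bu).
by rewrite scalerA mulrC -scalerA (az0 : _ = _) scaler0.
Qed.

Lemma degM_nonempty n x : Spec (colon (P n) x) ->
  exists t, degM [set q | colon (P n) x = q] n t.
Proof.
move=> pS; have [t pt] := prime_colon_comp M_graded hRP hP (sP n) (@gP n) pS erefl.
by exists t, (h t x); [exact: (comp_mem hP)|].
Qed.

(* Multiplication by a large power of y_i moves a witness x for n to one for n'. *)
Lemma colon_prime_out n x i n' : Spec (colon (P n) x) ->
  ~ colon (P n) x (y i) ->
  exists x', colon (P n) x = colon (P n') x'.
Proof.
move=> pS yi.
have powP m k z : P m z -> P (k + m)%N (y i ^+ k *: z).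
  move=> Pz; elim: k => [|k IH]; first by rewrite scale1r.
  by rewrite exprS -scalerA; apply: (dil_mem y i (sP (k + m)%N) IH).
exists (y i ^+ n' *: x); apply/seteqP; split=> a; rewrite /colon /= => Pa.
  rewrite scalerA mulrC -scalerA.
  by apply: (iter_dil_le sN (leq_addr n n')); apply: powP.
have := powP _ n _ Pa; rewrite !scalerA [_ * a]mulrC -mulrA -exprD.
move=> /(iter_dil_le sN (leq_addr n' n)).
case: (pS) => _ _ _ /(_ a (y i ^+ (n + n')))/[apply]-[//|/(primeX pS) yi'].
by case: yi.
Qed.

Let s0 : subm [set (0 : M)].
Proof. by split=> // a u v -> ->; rewrite scaler0 addr0. Qed.

Lemma degcolon_prime (z : M) : annih y z -> Spec (colon [set 0] z) ->
  exists t, degcolon [set q | colon [set 0] z = q] t.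
Proof.
move=> yz zS; have g0 : gsub h [set (0 : M)] by move=> u t ->; apply: comp0 hP _.
have [t pt] := prime_colon_comp M_graded hRP hP s0 g0 zS erefl.
exists t, (h t z); split; first exact: (gsub_annih M_graded hP yd).
  exact: (comp_mem hP).
by rewrite -pt.
Qed.

(** A maximal annihilator among those of nonzero elements of (0 :_M I) is prime, and some
    homogeneous component has the same annihilator. *)
Lemma degcolon_nonempty (x : M) : annih y x -> x != 0 ->
  exists t, degcolon (@Spec R) t.
Proof.
move=> yx x0.
pose X : set (set R^o) := [set J | exists z : M,
  [/\ annih y z, z != 0 & J = colon [set 0] z]].
have [_ [z [yz z0 ->]] zmax] : exists2 J, X J &
    forall J', X J' -> J `<=` J' -> J' `<=` J.
  apply: acc_max (acc_ideal nR) _ _ => [_ [z [_ _ ->]]|]; first exact: colon_subm.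
  by exists (colon [set 0] x), x.
have zS : Spec (colon [set 0] z : set R).
  have [c0 cP] := colon_subm z s0; split=> //.
    by rewrite /colon /= scale1r => z0'; rewrite z0' eqxx in z0.
  move=> a b abz; have [bz|bz] := pselect (colon [set 0] z b); first by right.
  left; apply: (zmax (colon [set 0] (b *: z))).
  - exists (b *: z); split=> //; first exact: (submZ b (@subm_annih _ _ y M) yz).
    by apply/eqP.
  - move=> e; rewrite /colon /= => ez.
    by rewrite scalerA mulrC -scalerA ez scaler0.
  - by rewrite /colon /= scalerA.
have [t [u [yu gu pu]]] := degcolon_prime yz zS.
by exists t, u; split=> //; rewrite -pu.
Qed.

(** [N] vanishes below some degree e and each factor from I raises degrees by at least 1, so I^(n-1)
    N vanishes below e + n - 1. Primality excludes the zero element as a witness. *)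
Lemma deggr_unbounded X t0 : (forall i, 1 <= d i)%N -> X `<=` @Spec R ->
  exists n0, forall n t, (n0 <= n)%N -> deggr X n t -> t0 <= t.
Proof.
move=> d1 XS; have [e eP] := lcomb_degree_ge M_graded hRP hP s.
exists `|t0 - e|%N.+1 => n t n0n [x [Px gx /XS pS]].
have := iter_dil_degree_ge M_graded hRP hP yd d1 (subset_trans Ns eP) Px.
move=> xe; rewrite leNgt; apply/negP => tt0.
have /xe : t < e + n.-1%:Z by lia.
rewrite (comp_id hP gx) => x0; apply: (notin_prime1 pS).
by rewrite /colon /= x0 scaler0; apply: (sP n).1.
Qed.

(** By [finitely_many_primes], the degrees form a finite union of sets [grdeg], one for each prime
    of the list that lies in [X]. *)
Lemma einf_deggr_linear X : X `<=` @Spec R ->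
  (forall n0, exists2 n, (n0 <= n)%N & deggr X n !=set0) ->
  exists i b, \forall n \near \oo,
    einf (deggr X n) = ((d i)%:Z * n%:Z + b)%:E%E.
Proof.
move=> XS Xne.
have [ps psP] := finitely_many_primes y nR sN Ns.
have : ev_min_lin d (fun n => deggr X n.+1).
  have := @ev_min_lin_bigcup _ d _ ps (fun p n =>
    [set t | X p /\ grdeg y N gM p n t]).
  move=> /(_ _)/(ev_min_lin_cofinal (n0 := 0%N)); apply=> [p _|n _].
    have [Xp|Xp] := pselect (X p); last by apply: (@ev_min_lin0 _ _ _ 0%N) =>
      n t _ [].
    have := ev_min_lin_grdeg nR sN Ns M_graded hRP hP yd gN (XS p Xp).
    move=> /(ev_min_lin_cofinal (n0 := 0%N)); apply => n _.
    by split=> [t|t [_ St]]; [|exists t].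
  split=> [t [p _ [Xp [x [Px gx px]]]]|t [x [Px gx Xx]]].
    by exists x; split=> //; rewrite -px.
  exists t => //; exists (colon (P n.+1) x); first exact/psP/XS.
  by split=> //; exists x.
move=> /ev_min_lin_nonempty[|i [b [n0 n0P]]].
  move=> n0; have [[|n] nn0 ne] := Xne n0.+1; first by [].
  by exists n.
(* The linear function was found for I^n N / I^(n+1) N, so the shift of the index lowers the
   intercept by [d i]. *)
exists i, (b - (d i)%:Z); apply/near_infty; exists n0.+1 => -[//|n] nn0.
have [Sn nS] := n0P n nn0.
have -> : (d i)%:Z * n.+1%:Z + (b - (d i)%:Z) = (d i)%:Z * n%:Z + b.
  by rewrite -addn1 PoszD; ring.
exact: einf_min.
Qed.

End Degrees.

(** A decomposition inside [N] is also one in [M], where components are unique. *)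
Lemma gsub_submod_grading (R : comPzRingType) (M : lmodType R)
    (gM : int -> set M) (h : int -> M -> M) (N : submodClosed M) :
  components gM h -> direct_sum (submod_grading gM N) -> gsub h [set x | x \in N].
Proof.
move=> hP [_ Nsum _] x t Nx.
have [s [f [gf xE]]] := Nsum (Sub x Nx).
have {xE}-> : x = \sum_(j <- s) val (f j) by rewrite -raddf_sum -xE.
rewrite (comp_sum hP); apply: subm_sum => [|j _].
  exact: subm_submodClosed.
rewrite (comp_homog hP _ (gf j)); case: eqP => _ /=; [exact: valP|exact: rpred0].
Qed.

Lemma submod_fg_lcomb (R : comPzRingType) (M : lmodType R) (N : submodClosed M) :
  finitely_generated (submod N) ->
  exists s : seq M, [set x | x \in N] `<=` lcomb s.
Proof.
move=> [s sP]; exists (map val s) => x Nx; have [s0 sD] := subm_lcomb (map val s).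
have := sP (Sub x Nx).
apply: (lspan_sub (K := [set z : submod N | lcomb (map val s) (val z)])) => [|z zs].
  by split=> [|a u v Ku Kv]; rewrite /mkset ?raddf0// linearP; apply: sD.
by apply: mem_lcomb; apply: map_f.
Qed.

(** * Comparison of the invariants through their sets of degrees *)

Theorem theorem3p11 (R : comPzRingType) (gR : nat -> set R)
  (M : lmodType R) (gM : int -> set M) (N : submodClosed M)
  (c : nat) (y : 'I_c -> R) (d : 'I_c -> nat) (I : submodClosed R^o)
  (R_noetherian : noetherian R)
  (R_graded : graded_ring gR)
  (M_graded : graded_module gR gM)
  (M_fg : finitely_generated M)
  (N_graded : graded_module gR (submod_grading gM N))
  (N_fg : finitely_generated (submod N))
  (y_homogeneous : forall i, gR (d i) (y i))
  (I_generated : (I : {pred R^o}) =i lspan (range y : set R^o)) :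
  let A := stableA N I in
  let B := stableB N I in
  let vM n := v_number (MmodIN_grading gM N I n) in
  let vM_ p n := v_local (MmodIN_grading gM N I n) p in
  let vgr n := v_number (grIN_grading gM N I n) in
  let vgr_ p n := v_local (grIN_grading gM N I n) p in
  let vcolon := v_number (colonI_grading gM I) in
  let vcolon_ p := v_local (colonI_grading gM I) p in
  [/\ forall p : set R, A p -> ~ Ass (colonI M I) p ->
        (forall a, a \in I -> p a) ->
        B p /\
        exists (i : 'I_c) (b : int), \forall n \near \oo,
          vM_ p n = vgr_ p n /\ vgr_ p n = ((d i)%:Z * n%:Z + b)%:E%E,
      forall p : set R, A p -> Ass (colonI M I) p ->
        (forall i, 1 <= d i)%N ->
        \forall n \near \oo, vM_ p n = v_local gM p /\ v_local gM p = vcolon_ p,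
      (exists2 x : M, x \in colon0 M I & x != 0) ->
        (\forall n \near \oo, (vM n <= vcolon)%E) /\
        ((forall i, 1 <= d i)%N -> A `<=` zero_locus (R := R) I ->
           \forall n \near \oo, vM n = vcolon)
    & (forall x : M, x \in colon0 M I -> x = 0) ->
        A !=set0 -> A `<=` zero_locus (R := R) I ->
        (\forall n \near \oo, vM n = vgr n) /\
        exists (i : 'I_c) (b : int), \forall n \near \oo,
          vgr n = ((d i)%:Z * n%:Z + b)%:E%E].
Proof.
move=> A B vM vM_ vgr vgr_ vcolon vcolon_.
have [R_sum _ _] := R_graded; have [hR hRP] := direct_sum_components R_sum.
have [h hP] := direct_sum_components M_graded.1.
pose NS := [set x | x \in N].
have sN : subm NS by exact: subm_submodClosed.
have gN := gsub_submod_grading hP N_graded.1.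
have [s Ns] := submod_fg_lcomb N_fg.
pose P n := iter n (dil y (M := M)) NS.
have PE n : [set z | z \in powN N I n] = P n.
  by apply/seteqP; split=> x /(mem_powN N I_generated).
have PS n : subm (P n) by apply: subm_iter_dil.
have yI i : y i \in I by apply: mem_I.
pose eqp (p : set R) : set (set R) := [set q | p = q].
have vME n : vM n = einf (degM y NS gM (@Spec R) n).
  by rewrite /vM v_numberE quotmod_degrees PE.
have vM_E n p : vM_ p n = einf (degM y NS gM (eqp p) n).
  by rewrite /vM_ v_localE (quotmod_degrees _ _ (eqp p)) PE.
have vgrE n : vgr n = einf (deggr y NS gM (@Spec R) n).
  rewrite /vgr v_numberE subquot_degrees PE; congr einf.
  by apply/seteqP; split=> t [x [Px gx Xx]]; exists x; split=> //;
    apply/(mem_powN N I_generated).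
have vgr_E n p : vgr_ p n = einf (deggr y NS gM (eqp p) n).
  rewrite /vgr_ v_localE (subquot_degrees _ _ _ (eqp p)) PE; congr einf.
  by apply/seteqP; split=> t [x [Px gx Xx]]; exists x; split=> //;
    apply/(mem_powN N I_generated).
have vcolonE : vcolon = einf (degcolon y gM (@Spec R)).
  rewrite /vcolon v_numberE submod_degrees; congr einf.
  by apply/seteqP; split=> t [x [Px gx Xx]]; exists x; split=> //;
    apply/(mem_colon0 I_generated).
have vcolon_E p : vcolon_ p = einf (degcolon y gM (eqp p)).
  rewrite /vcolon_ v_localE (submod_degrees _ _ (eqp p)); congr einf.
  by apply/seteqP; split=> t [x [Px gx Xx]]; exists x; split=> //;
    apply/(mem_colon0 I_generated).
have [n0 n0P] := degM_split R_noetherian sN Ns M_graded hP y_homogeneous gN.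
have AP p : A p -> Spec p /\ exists n0, forall n, (n0 <= n)%N -> exists x,
  p = colon (P n) x.
  move=> /near_infty[n1 n1P]; split; first by case: (n1P n1 (leqnn _)).
  exists n1 => n /n1P[_ [x ->]]; have [z ->] := quotmod_piP x.
  by exists z; rewrite ann_quotmod PE.
have AssCP p t : degcolon y gM (eqp p) t -> Spec p -> Ass (colonI M I) p.
  move=> [z [yz _ pz]] pS; split=> //.
  have Iz : z \in colon0 M I by apply/(mem_colon0 I_generated).
  by exists (Sub z Iz); rewrite submod_ann.
have AssC p : Ass (colonI M I) p -> exists2 z : M, annih y z & p = colon [set 0] z.
  move=> [pS [x ->]]; exists (val x); last exact: submod_ann.
  exact/(mem_colon0 I_generated)/(valP x).
have neM p n : Spec p -> (exists x,
  p = colon (P n) x) -> degM y NS gM (eqp p) n !=set0.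
  move=> pS [x px]; have := degM_nonempty sN M_graded hRP hP y_homogeneous gN (n :=
    n) (x := x).
  by rewrite -[iter _ _ _]/(P n) -px => /(_ pS)[t]; exists t.
have degMp p n : Spec p -> (forall i, p (y i)) -> (n0 <= n)%N ->
    degM y NS gM (eqp p) n = deggr y NS gM (eqp p) n `|` degcolon y gM (eqp p).
  by move=> pS py n0n; apply: n0P => // q; rewrite /eqp /= => <-.
(* The primes containing I, which are those covered by [degM_split]. *)
pose Y := [set q | Spec q /\ forall i, q (y i)].
have degMY n : (n0 <= n)%N ->
    degM y NS gM Y n = deggr y NS gM Y n `|` degcolon y gM Y.
  by move=> n0n; apply: n0P.
have YS : Y `<=` @Spec R by move=> q [].
have degcolonY : degcolon y gM Y = degcolon y gM (@Spec R).
  by apply/seteqP; split=> t [x [yx gx xS]]; exists x; split=> //; apply: YS.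
(* A prime annihilator omitting some [y i] is associated to every M / I^n' N by [colon_prime_out].
   It would thus belong to [A], which lies in V(I). *)
have primeY n x : A `<=` zero_locus (R :=
  R) I -> Spec (colon (P n) x) -> Y (colon (P n) x).
  move=> AI pS; split=> // i; apply: contrapT => pi.
  have Ap : A (colon (P n) x).
    apply/near_infty; exists 0%N => n' _; split=> //.
    have [x' ->] := colon_prime_out sN n' pS pi.
    by exists (quotmod_pi (powN N I n') x'); rewrite ann_quotmod PE.
  exact: pi ((AI _ Ap).2 _ (yI i)).
split.
- move=> p Ap nC Ip; have [pS [n1 n1P]] := AP p Ap.
  have py i : p (y i) by apply: Ip.
  (* Since [p] is not associated to (0 :_M I), the second part of the splitting is empty. *)
  have gr_p n : (n0 <= n)%N -> degM y NS gM (eqp p) n = deggr y NS gM (eqp p) n.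
    move=> n0n; rewrite degMp//; apply/seteqP; split=> t; last by left.
    by case=> // /AssCP; case/(_ pS)/nC.
  have gr_ne n : (n0 <= n)%N -> (n1 <= n)%N -> deggr y NS gM (eqp p) n !=set0.
    by move=> n0n n1n; rewrite -gr_p//; apply: neM => //; apply: n1P.
  split.
    apply/near_infty; exists (maxn n0 n1) => n; rewrite geq_max => /andP[n0n n1n].
    split=> //; have [t [x [Px gx ->]]] := gr_ne n n0n n1n.
    have Nx : x \in powN N I n.-1 by apply/(mem_powN N I_generated).
    by exists (quotmod_pi _ (Sub x Nx : submod _)); rewrite subquot_ann PE.
  have [||i [b /near_infty[n2 n2P]]] := einf_deggr_linear R_noetherian sN Ns
    M_graded hRP hP y_homogeneous gN (X := eqp p).
  + by move=> q; rewrite /eqp /= => <-.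
  + move=> m; exists (maxn m (maxn n0 n1)); first exact: leq_maxl.
    by apply: gr_ne; rewrite !leq_max leqnn !orbT.
  exists i, b; apply/near_infty; exists (maxn n0 n2) => n.
  by rewrite geq_max => /andP[n0n n2n]; rewrite vM_E vgr_E gr_p// n2P.
- move=> p Ap Cp d1; have [pS _] := AP p Ap.
  have [z yz pz] := AssC p Cp.
  have py i : p (y i) by rewrite pz; apply: yz.
  have [t0 Ct0] : exists t, degcolon y gM (eqp p) t.
    have := degcolon_prime M_graded hRP hP y_homogeneous yz.
    by rewrite -pz; apply.
  have [|n1 n1P] := deggr_unbounded sN Ns M_graded hRP hP y_homogeneous t0 d1 (X :=
    eqp p).
    by move=> q; rewrite /eqp /= => <-.
  apply/near_infty; exists (maxn n0 n1) => n; rewrite geq_max => /andP[n0n n1n].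
  (* As [p] contains I, every element of [M] with annihilator [p] lies in (0 :_M I). *)
  have -> : v_local gM p = vcolon_ p.
    rewrite vcolon_E v_localE; congr einf; apply/seteqP; split=> t.
      move=> [x gx px]; exists x; split=> // i; have := py i; by rewrite px.
    by move=> [x [_ gx px]]; exists x.
  split=> //; rewrite vM_E vcolon_E degMp//.
  by apply: einfU Ct0 _ => t; apply: n1P.
- move=> [x Cx x0]; have yx : annih y x by apply/(mem_colon0 I_generated).
  have [t0 Ct0] := degcolon_nonempty R_noetherian M_graded hRP hP y_homogeneous yx
    x0.
  split.
    apply/near_infty; exists n0 => n n0n; rewrite vME vcolonE; apply: einfS => t.
    rewrite -degcolonY => Ct.
    have [u gu /YS uS] : degM y NS gM Y n t by rewrite degMY//; right.
    by exists u.
  move=> d1 AI.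
  have [n1 n1P] := deggr_unbounded sN Ns M_graded hRP hP y_homogeneous t0 d1 YS.
  apply/near_infty; exists (maxn n0 n1) => n; rewrite geq_max => /andP[n0n n1n].
  rewrite vME vcolonE -degcolonY.
  have -> : degM y NS gM (@Spec R) n = degM y NS gM Y n.
    by apply/seteqP; split=> t [u gu uS]; exists u => //; [apply: primeY|apply: YS].
  rewrite degMY//; apply: (einfU (t0 := t0)); first by rewrite degcolonY.
  by move=> t; apply: n1P.
- move=> C0 [p Ap] AI.
  (* The part of the splitting from (0 :_M I) is empty: its only candidate is 0, whose annihilator
     is not prime. *)
  have grM n : (n0 <= n)%N -> degM y NS gM (@Spec R) n = deggr y NS gM (@Spec R) n.
    move=> n0n; apply/seteqP; split=> t; last by move=> [x [_ gx xS]]; exists x.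
    move=> [x gx xS]; have : degM y NS gM Y n t by exists x => //; apply: primeY.
    rewrite degMY// => -[[u [Pu gu /YS uS]]|[u [yu gu /YS uS]]]; first by exists u.
    have u0 : u = 0 by apply: C0; apply/(mem_colon0 I_generated).
    by case: (notin_prime1 uS); rewrite /colon /= u0 scaler0.
  have [pS [n1 n1P]] := AP p Ap.
  split; first by apply/near_infty; exists n0 => n n0n; rewrite vME vgrE grM.
  have [//||i [b /near_infty[n2 n2P]]] := einf_deggr_linear R_noetherian sN Ns
    M_graded hRP hP y_homogeneous gN (X := @Spec R).
    move=> m; exists (maxn m (maxn n0 n1)); first exact: leq_maxl.
    rewrite -grM ?leq_max ?leqnn ?orbT//.
    have [|t [x gx px]] := neM p (maxn m (maxn n0 n1)) pS.
      by apply: n1P; rewrite !leq_max leqnn !orbT.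
    by exists t, x => //; rewrite -px.
  by exists i, b; apply/near_infty; exists n2 => n n2n; rewrite vgrE n2P.
Qed.
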